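(* Let $n$ be a positive integer, let $k=\lceil n/2\rceil$, and let $m$ be an integer with \[\binom{n}{2}-\left\lfloor\frac{(n+1)^2}{8}\right\rfloor\leq m\leq\binom{n}{k}-k\left\lceil\frac{k+1}{2}\right\rceil.\] Then there exist an integer $l\in\{2,3,\dots,\lfloor (n-2)/2\rfloor\}$ and a maximal antichain $\mathcal A$ in $B_n$ with $\mathcal A\subseteq\binom{[n]}{l}\cup\binom{[n]}{l+1}$ and $|\mathcal A|=m$.
   Context: $B_n$ is the Boolean lattice of all subsets of $[n]=\{1,\dots,n\}$ ordered by inclusion; $\binom{[n]}{l}$ denotes the family of all $l$-element subsets of $[n]$. An antichain is a family of subsets none of which contains another; it is maximal if no further subset of $[n]$ can be added while preserving the antichain property.
   Formalization: The formal theorem assumes n > 2 instead of n positive: for n = 1 (m = 0) and n = 2 (m = 0, 1) the bounds on m are met but the set {2,...,floor((n-2)/2)} is empty, so the claim fails there. *)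

(* Defs.v *)
From mathcomp Require Import all_boot all_order all_algebra.

Set Implicit Arguments.
Unset Strict Implicit.
Unset Printing Implicit Defensive.

(* The ground set [n] = {1, ..., n} is represented by 'I_n = {0, ..., n-1}. *)

Definition antichain (n : nat) (A : {set {set 'I_n}}) : Prop :=
  forall X Y : {set 'I_n}, X \in A -> Y \in A -> X \subset Y -> X = Y.

Definition maximal_antichain (n : nat) (A : {set {set 'I_n}}) : Prop :=
  antichain A /\
  forall X : {set 'I_n}, X \notin A -> ~ antichain (X |: A).

Definition level (n l : nat) : {set {set 'I_n}} :=
  [set X : {set 'I_n} | #|X| == l].

(* Main.v *)
Require Import Defs.
From Stdlib Require Import ZArith Lia.

(** An antichain in levels l and l+1 is determined by its set E of missing
    l-sets.  With cl E the family of (l+1)-sets all of whose l-subsets lie in E,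
    ([n] choose l) \ E together with cl E is a maximal antichain as soon as
    every member of E lies in a member of cl E, and it has size
    C(n,l) - (|E| - |cl E|).  So one has to realize weights |E| - |cl E|.

    All families are built by one operation: given a family N of (l-1)-sets,
    join a new point v to every member of N; the weight grows by |N| minus the
    number of members of E whose shadow lies in N.  Coning the complete l-graph
    on c points with families one level lower gives, by induction on l, a
    contiguous range of weights at each level; cones over graphs extend the
    range upwards until it meets the range of the level below.

    The induction starts with l = 2, the weights |edges| - |triangles| of graphs
    in which every edge lies in a triangle.  Large weights come from a matching
    with independent vertices joined to both ends of some matching edges; the
    most negative ones from K_n minus a star and a linear forest, or from
    K_(n-2) with two more adjacent vertices. *)

(** * The arithmetic of nearly complete graphs *)

Local Open Scope Z_scope.

(** [y] is the weight gained over the complete graph on [k + 3] vertices by deleting a star with [s]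
    leaves, a path of [b + 1] edges and [r] single edges, all disjoint. Each deleted edge gains [k],
    and each pair of adjacent deleted edges takes back one. The inequality fits everything into
    [k + 2] vertices, leaving one vertex intact. *)
Definition spans_star_forest (k y : Z) := exists s b r,
  0 <= s /\ 0 <= b /\ 0 <= r /\ s + b + 2 * r <= k - 1 /\
  2 * y = 2 * (s + 1 + b + r) * k - s * (s - 1) - 2 * b.

(** Here the graph is complete on [k + 1] vertices, which alone gives [k * k - 2], with two adjacent
    extra vertices having [t] and [a] neighbours there, [g] of them common. *)
Definition spans_double (k y : Z) := exists t a g,
  2 <= t /\ 2 <= a /\ 1 <= g /\ g <= a /\ g <= t /\ t + a <= k + 1 + g /\
  2 * (k * k - 2 - y) = t * (t - 3) + a * (a - 3) + 2 * (g - 1).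

Lemma crossing (f : Z -> Z) (p N : Z) : 0 <= N -> f 0 <= p -> p < f N ->
  exists s, 0 <= s /\ f s <= p /\ p < f (s + 1).
Proof.
intros HN H0; revert N HN.
apply (natlike_ind (fun N => p < f N ->
  exists s, 0 <= s /\ f s <= p /\ p < f (s + 1))).
  lia.
intros N HN IH HS; destruct (Z.lt_ge_cases p (f N)) as [H|H]; [auto|].
exists N; rewrite Z.add_1_r; auto.
Qed.

Lemma half_tri (s : Z) : exists c, s * (s - 1) = 2 * c.
Proof.
destruct (Z.Even_or_Odd s) as [[c ->]|[c ->]].
  exists (c * (2 * c - 1)); ring.
exists ((2 * c + 1) * c); ring.
Qed.

(** Greedy choice of [t]: the next value of [t (t - 3) / 2] is larger by [t - 1], which bounds the
    remainder. *)
Lemma tri_crossing (R : Z) : 0 <= R ->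
  exists t r, 3 <= t /\ 0 <= r /\ 2 * R = t * (t - 3) + 2 * r /\ r < t - 1.
Proof.
intros HR.
destruct (crossing (fun i => (i + 3) * i) (2 * R) (2 * R + 1)) as [i Hi]; try nia.
destruct (half_tri i) as [c Hc].
exists (i + 3), (R - c - 2 * i); nia.
Qed.

(** With [b = p - s (s - 1) / 2], the first inequality says [b >= max 0 (d - s)], which makes the
    star forest fit; the second bounds [b] above so that [r >= 0] can be shown. *)
Lemma star_crossing (d p : Z) : 0 <= d <= p -> exists s,
  0 <= s /\ s * (s - 1) + 2 * Z.max 0 (d - s) <= 2 * p /\
  2 * p < (s + 1) * s + 2 * Z.max 0 (d - s - 1).
Proof.
intros H.
destruct (crossing (fun s => s * (s - 1) + 2 * Z.max 0 (d - s)) (2 * p) (2 * p + 2))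
  as (s & Hs & Hs1 & Hs2); [lia|lia| |exists s; lia].
assert (0 <= p * p) by nia; lia.
Qed.

(* Write [R = k^2 - 2 - y] greedily as a sum of two numbers [t (t - 3) / 2] and
   [a (a - 3) / 2] plus a remainder below [a - 1].  If the two neighbourhoods do
   not fit ([a + t > k + 2]) then [t] is within O(sqrt k) of [k], so [y] is small
   and a star with about [sqrt (2 k)] leaves plus a linear forest reaches it. *)
Lemma spans_large (k y : Z) : 27 <= k -> k * (k + 1) <= 2 * y -> y <= k * k - 2 ->
  spans_star_forest k y \/ spans_double k y.
Proof.
intros Hk Hy1 Hy2.
destruct (tri_crossing (k * k - 2 - y)) as (t & R' & Ht & HR' & Et & HRt); [lia|].
destruct (tri_crossing R') as (a & g & Ha & Hg & Ea & Hga); [lia|].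
assert (Hat : a <= t) by nia.
destruct (Z.le_gt_cases (a + t) (k + 2)) as [Hta|Hta].
  right; exists t, a, (g + 1); repeat split; lia.
left.
assert (Htk : t <= k) by nia.
assert (exists e, e = k - t) as [e Ee] by eauto.
(* Since [a >= e + 3] and [a (a - 3) <= 2 R' < 2 (t - 1)], [e] is O(sqrt k). *)
assert (He : (e + 3) * e <= 2 * (k - e) - 3).
  assert ((e + 3) * e <= a * (a - 3)) by (apply Z.mul_le_mono_nonneg; lia).
  lia.
(* The number of deleted edges: the largest [m] for which [p = m k - y] is at most [2 m - 3].
   Maximality gives [p >= d + 1] below. *)
set (m := (y - 3) / (k - 2)).
assert (Hm : m * (k - 2) <= y - 3 < (m + 1) * (k - 2)).
  pose proof (Z.div_mod (y - 3) (k - 2)); pose proof (Z.mod_pos_bound (y - 3) (k - 2)).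
  fold m in H; nia.
assert (Hmk : k + 2 <= 2 * m).
  apply Z.le_ngt; intros Hn.
  pose proof (Z.mul_nonneg_nonneg (k + 1 - 2 * m) (k - 2)); lia.
assert (Hme : 2 * m <= k + 2 * e + 5).
  assert (Et' : t = k - e) by lia; rewrite Et' in Et.
  apply Z.le_ngt; intros Hn.
  pose proof (Z.mul_nonneg_nonneg (2 * m - k - 2 * e - 6) (k - 2)).
  pose proof (Z.mul_nonneg_nonneg e (e - 1)).
  assert (e = 0 \/ 1 <= e) by lia; nia.
set (p := m * k - y); set (d := 2 * m - k - 1).
assert (Hp : d + 1 <= p <= 2 * m - 3) by lia.
destruct (star_crossing d p) as (s & Hs & Hs1 & Hs2); [lia|].
destruct (half_tri s) as [c Hc].
assert (Hs3 : s * s - 3 * s <= 2 * k - 4) by lia.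
(* [star_crossing] gives [b <= d - 2] or [b <= s - 1]. This bound yields [r >= 0] in the first case,
   [Hsm2] in the second. *)
assert (Hsm : s <= k + 2 - m).
  apply Z.le_ngt; intros Hn.
  assert (k <= 2 * s + 2 * e - 1) by lia.
  assert (s * s - 11 * s + e * e - 3 * e + 11 <= 0) by lia.
  pose proof (Z.mul_nonneg_nonneg (s + e) (s + e - 14)).
  pose proof (Z.square_nonneg (s - e - 4)); lia.
assert (Hsm2 : 2 * s <= m).
  apply Z.le_ngt; intros Hn.
  assert (s * s - 9 * s + 10 <= 0) by lia.
  pose proof (Z.mul_nonneg_nonneg (s - 8) (s - 1)); lia.
exists s, (p - c), (m - s - 1 - (p - c)); repeat split; try lia.
Qed.

(** * Exhaustive search for small [k] *)

(** The [if] keeps the search lazy under [vm_compute], which evaluates arguments of boolean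
    connectives first. *)
Fixpoint any (f : Z -> bool) (n : nat) (i : Z) : bool :=
  match n with
  | O => false
  | S n' => if f i then true else any f n' (i + 1)
  end.

Lemma any_ex f n i : any f n i = true -> exists j, i <= j /\ f j = true.
Proof.
revert i; induction n as [|n IH]; intros i; simpl; [discriminate|].
destruct (f i) eqn:E; [exists i; split; [lia|easy]|].
intros H; destruct (IH _ H) as (j & Hj & Ej); exists j; split; [lia|easy].
Qed.

Fixpoint every (f : Z -> bool) (n : nat) (i : Z) : bool :=
  match n with
  | O => true
  | S n' => if f i then every f n' (i + 1) else false
  end.

Lemma every_all f n i : every f n i = true ->
  forall j, i <= j < i + Z.of_nat n -> f j = true.
Proof.
revert i; induction n as [|n IH]; intros i; simpl; [lia|].
destruct (f i) eqn:E; [|discriminate]; intros H j Hj.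
destruct (Z.eq_dec j i) as [->|]; [easy|apply (IH _ H); lia].
Qed.

(** Given [s], [m] is the least number of deleted edges making [b] nonnegative; [b] and [r] are then
    forced. *)
Definition star_forest_check (k y s : Z) : bool :=
  let c := s * (s - 1) / 2 in
  let m := (y + c + k - 1) / k in
  let b := m * k - c - y in
  let r := m - s - 1 - b in
  if 0 <=? r then s + b + 2 * r <=? k - 1 else false.

Definition double_check (k y t a : Z) : bool :=
  let g := k * k - 1 - y - t * (t - 3) / 2 - a * (a - 3) / 2 in
  if 1 <=? g then
    if g <=? a then if g <=? t then t + a <=? k + 1 + g else false else false
  else false.

Definition spans_check (k y : Z) : bool :=
  if any (star_forest_check k y) (Z.to_nat k) 0 then true else
  (* The values 2 to 11 of [a] are enough in the range that [small_checks] computes. *)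
  any (fun t => any (double_check k y t) 10 2) (Z.to_nat k) 2.

(** [(k + 3) (k + 2) (2 - k)] is six times the weight of the complete graph on [k + 3] vertices, so
    only total weights at most 1 are tested. *)
Definition small_check (k : Z) : bool :=
  every (fun y => if (k + 3) * (k + 2) * (2 - k) + 6 * y <=? 6
                  then spans_check k y else true)
    (Z.to_nat (k * k - k * (k + 1) / 2)) (k * (k + 1) / 2).

Lemma small_checks : every small_check 24 3 = true.
Proof. vm_compute. reflexivity. Qed.

Lemma spans_small (k y : Z) : 3 <= k <= 26 -> k * (k + 1) <= 2 * y ->
  y <= k * k - 2 -> (k + 3) * (k + 2) * (2 - k) + 6 * y <= 6 ->
  spans_star_forest k y \/ spans_double k y.
Proof.
intros Hk Hy1 Hy2 Hy3.
assert (C : spans_check k y = true).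
  pose proof (every_all _ _ _ small_checks k ltac:(lia)) as Ck.
  unfold small_check in Ck.
  destruct (half_tri (k + 1)) as [c Hc].
  assert (E : k * (k + 1) / 2 = c).
    replace (k * (k + 1)) with (c * 2) by lia; apply Z.div_mul; lia.
  rewrite E in Ck.
  pose proof (every_all _ _ _ Ck y ltac:(lia)) as Cy; cbv beta in Cy.
  rewrite (proj2 (Z.leb_le _ _) Hy3) in Cy; exact Cy.
unfold spans_check in C.
destruct (any (star_forest_check k y) (Z.to_nat k) 0) eqn:A.
  left; destruct (any_ex _ _ _ A) as (s & Hs & Cs).
  unfold star_forest_check in Cs.
  destruct (half_tri s) as [c Hc].
  assert (E : s * (s - 1) / 2 = c) by (rewrite Hc, Z.mul_comm; apply Z.div_mul; lia).
  rewrite E in Cs; clear E.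
  set (m := (y + c + k - 1) / k) in *.
  assert (0 <= m * k - c - y).
    pose proof (Z.div_mod (y + c + k - 1) k ltac:(lia)).
    pose proof (Z.mod_pos_bound (y + c + k - 1) k ltac:(lia)).
    fold m in H; lia.
  destruct (Z.leb_spec 0 (m - s - 1 - (m * k - c - y))); [|discriminate].
  apply Z.leb_le in Cs.
  exists s, (m * k - c - y), (m - s - 1 - (m * k - c - y)); lia.
right; destruct (any_ex _ _ _ C) as (t & Ht & Ct).
destruct (any_ex _ _ _ Ct) as (a & Ha & Cta).
unfold double_check in Cta.
assert (half : forall x, exists h, x * (x - 3) = 2 * h /\ x * (x - 3) / 2 = h).
  intros x; destruct (half_tri x) as [h Hh]; exists (h - x); split; [lia|].
  replace (x * (x - 3)) with ((h - x) * 2) by lia; apply Z.div_mul; lia.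
destruct (half t) as (h1 & E1 & F1); destruct (half a) as (h2 & E2 & F2).
rewrite F1, F2 in Cta.
set (g := k * k - 1 - y - h1 - h2) in *.
destruct (Z.leb_spec 1 g); [|discriminate].
destruct (Z.leb_spec g a); [|discriminate].
destruct (Z.leb_spec g t); [|discriminate].
apply Z.leb_le in Cta.
exists t, a, g; lia.
Qed.

Lemma spans (k y : Z) : 3 <= k -> k * (k + 1) <= 2 * y ->
  y <= k * k - 2 -> (k + 3) * (k + 2) * (2 - k) + 6 * y <= 6 ->
  spans_star_forest k y \/ spans_double k y.
Proof.
intros; destruct (Z.le_gt_cases k 26); [now apply spans_small|].
apply spans_large; lia.
Qed.

Lemma spans_nat (k y : nat) :
  (3 <= k -> k * (k + 1) <= 2 * y -> y + 2 <= k * k ->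
   (k + 3) * (k + 2) * 2 + 6 * y <= 6 + (k + 3) * (k + 2) * k ->
  (exists s b r, s + b + 2 * r + 1 <= k /\
     2 * y + s * s + 2 * b = 2 * (s + 1 + b + r) * k + s) \/
  (exists t a g, 2 <= t /\ 2 <= a /\ 1 <= g /\ g <= a /\ g <= t /\
     t + a <= k + 1 + g /\
     2 * (k * k) + 3 * t + 3 * a = 2 * y + 2 + t * t + a * a + 2 * g))%nat.
Proof.
intros Hk Hy1 Hy2 Hy3.
destruct (spans (Z.of_nat k) (Z.of_nat y)) as [H|H]; try lia.
- left; destruct H as (s & b & r & H).
  exists (Z.to_nat s), (Z.to_nat b), (Z.to_nat r).
  rewrite <- (Z2Nat.id s), <- (Z2Nat.id b), <- (Z2Nat.id r) in H by lia.
  lia.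
- right; destruct H as (t & a & g & H).
  exists (Z.to_nat t), (Z.to_nat a), (Z.to_nat g).
  rewrite <- (Z2Nat.id t), <- (Z2Nat.id a), <- (Z2Nat.id g) in H by lia.
  lia.
Qed.
Close Scope Z_scope.

From mathcomp Require Import all_boot all_order all_algebra.
From mathcomp Require Import zify.

Set Implicit Arguments.
Unset Strict Implicit.
Unset Printing Implicit Defensive.

Import Order.TTheory GRing.Theory Num.Theory.

(** * Families of l-sets and joining a new point *)

Section Families.
Variable T : finType.
Implicit Types (D X Z e : {set T}) (E N : {set {set T}}) (v x : T).

(* The empty set is excluded because it would satisfy the condition vacuously. *)
Definition cl E : {set {set T}} :=
  [set X | (X != set0) && [forall x in X, X :\ x \in E]].

Definition wt E : int := (#|E|%:Z - #|cl E|%:Z)%R.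

Definition pure E := forall e, e \in E -> exists2 X, X \in cl E & e \subset X.

Definition sets_on D l E := forall e, e \in E -> e \subset D /\ #|e| = l.

Definition real D l (z : int) := exists E, [/\ sets_on D l E, pure E & wt E = z].

Lemma clP E X :
  reflect (X != set0 /\ forall x, x \in X -> X :\ x \in E) (X \in cl E).
Proof.
rewrite inE; apply: (iffP andP) => -[X0 XE]; split=> //.
  by move=> x xX; apply: (forall_inP XE).
by apply/forall_inP.
Qed.

Lemma card_cl D l E X : sets_on D l E -> X \in cl E -> #|X| = l.+1.
Proof.
move=> DE /clP[/set0Pn[x xX] XE].
by have [_ <-] := DE _ (XE x xX); rewrite (cardsD1 x X) xX.
Qed.

(** A point of [X] survives the removal of another one, so it lies in a member of [E]. For [l = 0]
    there is no other point: the empty set in [E] puts every singleton into [cl E]. *)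
Lemma cl_sub D l E X : 0 < l -> sets_on D l E -> X \in cl E -> X \subset D.
Proof.
move=> l0 DE XE; have sX := card_cl DE XE; case/clP: XE => _ XE.
apply/subsetP=> x xX.
have /set0Pn[y /setD1P[yx yX]] : X :\ x != set0.
  by rewrite -card_gt0; move: (cardsD1 x X); rewrite xX; lia.
have [/subsetP/(_ x) + _] := DE _ (XE y yX).
by rewrite !inE eq_sym yx xX => /(_ isT).
Qed.

Lemma onS D D' l E : D \subset D' -> sets_on D l E -> sets_on D' l E.
Proof. by move=> DD' DE e /DE[eD <-]; split=> //; apply: subset_trans DD'. Qed.

Lemma real_sub D D' l z : D \subset D' -> real D l z -> real D' l z.
Proof. by move=> DD' [E [DE pE wE]]; exists E; split=> //; apply: onS DE. Qed.

Lemma notin_on D l v E X : v \notin D -> sets_on D l E -> X \in E -> v \notin X.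
Proof. by move=> vD DE /DE[/subsetP XD _]; apply: contra vD => /XD. Qed.

Definition apex v E N := E :|: [set v |: e | e in N].

Lemma mem_apex D l v E N X : v \notin D -> sets_on D l.+1 E -> sets_on D l N ->
  (X \in apex v E N) = if v \in X then X :\ v \in N else X \in E.
Proof.
move=> vD DE DN; rewrite inE.
have vE e := notin_on (X := e) vD DE.
have vN e := notin_on (X := e) vD DN.
case: ifPn => vX.
  have /negbTE-> /= : X \notin E by apply/negP=> /vE; rewrite vX.
  apply/imsetP/idP => [[e eN ->]|XN]; first by rewrite setU1K ?vN.
  by exists (X :\ v); rewrite ?setD1K.
rewrite orbC; case: imsetP => //= -[e _ eX]; by rewrite eX setU11 in vX.
Qed.

Lemma on_apex D l v E N : sets_on D l.+1 E -> sets_on D l N -> v \notin D ->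
  sets_on (v |: D) l.+1 (apex v E N).
Proof.
move=> DE DN vD e; rewrite inE => /orP[/DE[eD ->]|/imsetP[f /DN[fD fl] ->]].
  by split=> //; apply: subset_trans eD (subsetUr _ _).
split; first exact: setUS.
by rewrite cardsU1 fl (contra _ vD) // => /(subsetP fD).
Qed.

(** If [v] lies in [X], deleting [v] tests membership in [E], and deleting any other point tests
    membership in [N]. *)
Lemma mem_cl_apex D l v E N X : v \notin D -> sets_on D l.+1 E -> sets_on D l N ->
  (X \in cl (apex v E N)) =
  if v \in X then X :\ v \in E :&: cl N else X \in cl E.
Proof.
move=> vD DE DN; have memA := mem_apex _ vD DE DN.
case: ifPn => vX; last first.
  apply/clP/clP => -[X0 XE]; split=> // x xX; have := XE x xX;
    by rewrite memA !inE (negbTE vX) andbF.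
apply/clP/setIP => [[X0 XE]|[XE /clP[_ XN]]].
  have XvE : X :\ v \in E by have := XE v vX; rewrite memA !inE eqxx.
  split=> //; apply/clP; split; first by rewrite -card_gt0 (DE _ XvE).2.
  move=> x /setD1P[xv xX]; have := XE x xX; rewrite memA !inE eq_sym xv vX /=.
  by rewrite setDDl setUC -setDDl.
split; first by apply/set0Pn; exists v.
move=> x xX; rewrite memA !inE; have [-> | xv] := eqVneq x v.
  exact: XE.
rewrite vX /= setDDl setUC -setDDl; apply: XN.
by rewrite !inE xv.
Qed.

Lemma card_split v (A B C : {set {set T}}) :
    (forall X, (X \in A) = if v \in X then X :\ v \in C else X \in B) ->
    (forall X, X \in B -> v \notin X) -> (forall X, X \in C -> v \notin X) ->
  #|A| = #|B| + #|C|.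
Proof.
move=> memA vB vC.
rewrite -(cardsID [set X : {set T} | v \in X] A) addnC; congr (_ + _).
  apply: eq_card => X; rewrite !inE memA.
  by case: (boolP (v \in X)) => //= vX; apply/esym/negP=> /vB; rewrite vX.
have <- : #|[set v |: e | e in C]| = #|C|.
  apply: card_in_imset => X Y /vC vX /vC vY /(congr1 (fun e => e :\ v)).
  by rewrite !setU1K.
apply: eq_card => X; rewrite !inE memA.
apply/andP/imsetP => [[+ vX]|[e eC ->]]; first rewrite vX.
  by move=> XC; exists (X :\ v); rewrite ?setD1K.
by rewrite setU11 setU1K ?vC.
Qed.

Lemma card_apex D l v E N : v \notin D -> sets_on D l.+1 E -> sets_on D l N ->
  #|apex v E N| = #|E| + #|N|.
Proof.
move=> vD DE DN; apply: (card_split (v := v)) => X; last 2 first.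
- exact: notin_on vD DE.
- exact: notin_on vD DN.
exact: mem_apex vD DE DN.
Qed.

Lemma wt_apex D l v E N : v \notin D -> sets_on D l.+1 E -> sets_on D l N ->
  wt (apex v E N) = (wt E + (#|N|%:Z - #|E :&: cl N|%:Z))%R.
Proof.
move=> vD DE DN; rewrite /wt (card_apex vD DE DN).
rewrite (card_split (fun X => mem_cl_apex X vD DE DN)); first lia.
  by move=> X XE; apply: contra vD => /(subsetP (cl_sub (ltn0Sn l) DE XE)).
by move=> X /setIP[XE _]; apply: notin_on vD DE XE.
Qed.

(** A member [e] of [E] whose shadow lies in [N] is covered by [v |: e]; only the others need a
    cover from [cl E]. *)
Lemma pure_apex D l v E N : v \notin D -> sets_on D l.+1 E -> sets_on D l N ->
  (forall e, e \in N -> exists2 Z, Z \in E :&: cl N & e \subset Z) ->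
  (forall e, e \in E -> e \in cl N \/ exists2 X, X \in cl E & e \subset X) ->
  pure (apex v E N).
Proof.
move=> vD DE DN pN pE.
have vE X := notin_on (X := X) vD DE.
have clU Z : Z \in E :&: cl N -> v |: Z \in cl (apex v E N).
  move=> ZEN; rewrite (mem_cl_apex _ vD DE DN) setU11 setU1K //.
  by apply: vE; case/setIP: ZEN.
move=> e; rewrite inE => /orP[eE|/imsetP[f fN ->]]; last first.
  by have [Z /clU ? fZ] := pN _ fN; exists (v |: Z); rewrite ?setUS.
have [eN | [X XE eX]] := pE _ eE.
  by exists (v |: e); rewrite ?subsetUr // clU // inE eE.
exists X => //; rewrite (mem_cl_apex _ vD DE DN) ifN //.
by apply: contra vD => /(subsetP (cl_sub (ltn0Sn l) DE XE)).
Qed.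

Definition subsets l D := [set X : {set T} | (X \subset D) && (#|X| == l)].

Lemma on_subsets l D : sets_on D l (subsets l D).
Proof. by move=> e; rewrite inE => /andP[? /eqP]. Qed.

Lemma card_subsets l D : #|subsets l D| = 'C(#|D|, l).
Proof. exact: cards_draws. Qed.

Lemma cl_subsets l D : cl (subsets l.+1 D) = subsets l.+2 D.
Proof.
apply/setP=> X; rewrite [RHS]inE; apply/idP/andP => [XE|[XD /eqP sX]].
  by rewrite (cl_sub (ltn0Sn l) (@on_subsets _ _) XE) (card_cl (@on_subsets _ _) XE).
apply/clP; split=> [|x xX]; first by rewrite -card_gt0 sX.
rewrite inE (subset_trans (subsetDl _ _)) //=.
by move: (cardsD1 x X); rewrite xX sX; lia.
Qed.

Lemma cl_on_sub D l N : sets_on D l.+1 N -> cl N \subset subsets l.+2 D.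
Proof.
move=> DN; apply/subsetP=> X XN; rewrite inE.
by rewrite (cl_sub (ltn0Sn l) DN XN) (card_cl DN XN) eqxx.
Qed.

End Families.

Lemma ex_between (T : finType) (A B : {set T}) k : A \subset B ->
  #|A| <= k <= #|B| -> exists S : {set T}, [/\ A \subset S, S \subset B & #|S| = k].
Proof.
move=> AB /andP[/subnKC <-]; elim: (k - #|A|) => [|i IHi] kB.
  by exists A; rewrite addn0.
have [|S [AS SB sS]] := IHi; first lia.
have [x xB xS] : exists2 x, x \in B & x \notin S.
  by apply/subsetPn/negP => /subset_leq_card; lia.
exists (x |: S); split; last by rewrite cardsU1 xS sS; lia.
  by rewrite (subset_trans AS) ?subsetUr.
by rewrite subUset sub1set xB.
Qed.

Lemma ex_subset (T : finType) (B : {set T}) k : k <= #|B| ->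
  exists2 S : {set T}, S \subset B & #|S| = k.
Proof.
move=> kB; have [|S [_ ? ?]] := @ex_between T set0 B k (sub0set _).
  by rewrite cards0.
by exists S.
Qed.

(** * From pure families to maximal antichains *)

(** Purity puts every l-set below a member of [A], and the definition of [cl] puts every (l+1)-set
    above one. Any other set extends to such an l-set or contains such an (l+1)-set. *)
Lemma pure_maximal n l (E : {set {set 'I_n}}) : 0 < l < n ->
  sets_on setT l E -> pure E ->
  let A := (level n l :\: E) :|: cl E in
  [/\ maximal_antichain A, A \subset level n l :|: level n l.+1
    & (#|A|%:Z = 'C(n, l)%:Z - wt E)%R].
Proof.
move=> /andP[l0 ln] TE pE A.
have sE (e : {set 'I_n}) : e \in E -> #|e| = l by case/TE.
have sC (X : {set 'I_n}) : X \in cl E -> #|X| = l.+1 by exact: card_cl TE.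
have memA (X : {set 'I_n}) : X \in A -> (#|X| = l /\ X \notin E) \/ (#|X| = l.+1 /\ X \in cl E).
  rewrite in_setU in_setD inE => /orP[/andP[? /eqP]|XC]; first by left.
  by right; rewrite sC.
have Asub : A \subset level n l :|: level n l.+1.
  apply/subsetP=> X /memA[[sX _]|[sX _]]; by rewrite !inE sX eqxx ?orbT.
have clA (X : {set 'I_n}) : X \in cl E -> X \in A by move=> XC; rewrite in_setU XC orbT.
have lvA (X : {set 'I_n}) : #|X| = l -> X \notin E -> X \in A.
  by move=> /eqP sX XE; rewrite in_setU in_setD inE sX XE.
have bad (X Y : {set 'I_n}) : X \notin A -> Y \in A -> X \subset Y \/ Y \subset X ->
    ~ antichain (X |: A).
  move=> XA YA XY anti; have [XX YY] : X \in X |: A /\ Y \in X |: A.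
    by rewrite !in_setU1 YA eqxx orbT.
  have eXY : X = Y.
    by case: XY => [XY|YX]; [apply: anti|apply/esym/anti].
  by rewrite eXY YA in XA.
have down (Z : {set 'I_n}) : #|Z| = l.+1 -> exists2 Y, Y \in A & Y \subset Z.
  move=> sZ; have [ZC|] := boolP (Z \in cl E); first by exists Z; auto.
  have Z0 : Z != set0 by rewrite -card_gt0 sZ.
  rewrite inE Z0 => /forall_inPn[x xZ xE]; exists (Z :\ x); last exact: subsetDl.
  by apply: lvA => //; move: (cardsD1 x Z); rewrite xZ sZ; lia.
have up (Z : {set 'I_n}) : #|Z| = l -> exists2 Y, Y \in A & Z \subset Y.
  move=> sZ; have [ZE|] := boolP (Z \in E); last by exists Z; auto.
  by have [Y YC ZY] := pE Z ZE; exists Y; auto.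
split=> //.
  split=> [X Y XA YA XY|X XA].
    have := subset_leq_card XY.
    case: (memA _ XA) (memA _ YA) => -[sX hX] [] [sY hY] sXY;
      try (apply/eqP; rewrite eqEcard XY; lia).
    have [_ YE] := clP _ _ hY.
    have [z zY zX] : exists2 z, z \in Y & z \notin X.
      by apply/subsetPn/negP => /subset_leq_card; lia.
    have eX : X = Y :\ z.
      apply/eqP; rewrite eqEcard subsetD1 XY zX /= sX.
      by move: (cardsD1 z Y); rewrite zY sY add1n => -[->].
    by rewrite eX YE in hX.
  have [sX|sX] := leqP #|X| l.
    have [|Z [XZ _ sZ]] := @ex_between _ X setT l (subsetT _).
      by rewrite sX cardsT card_ord ltnW.
    have [Y YA ZY] := up Z sZ.
    by apply: (bad X Y) => //; left; apply: subset_trans ZY.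
  have [Z ZX sZ] := ex_subset sX.
  have [Y YA YZ] := down Z sZ.
  by apply: (bad X Y) => //; right; apply: subset_trans ZX.
have dis : (level n l :\: E) :&: cl E = set0.
  apply/setP=> X; rewrite in_setI in_setD inE in_set0.
  by apply/negP=> /andP[/andP[_ /eqP sX] /sC]; lia.
have El : E \subset level n l by apply/subsetP=> e /sE sEe; rewrite inE sEe.
have sL : #|level n l| = 'C(n, l).
  rewrite -[in RHS](card_ord n) -cardsT -card_subsets.
  by apply: eq_card => X; rewrite !inE subsetT.
rewrite /wt /A cardsU dis cards0 cardsD (setIidPr El) sL.
have := subset_leq_card El; rewrite sL; lia.
Qed.

(** * Joining points and iterated cones *)

Section Recursion.
Variable T : finType.
Implicit Types (A C D V X Z e : {set T}) (E N F G : {set {set T}}) (v x : T).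

Lemma pure_subsets D l : l.+1 < #|D| -> pure (subsets l.+1 D).
Proof.
move=> lD e; rewrite inE => /andP[eD /eqP se].
have [|S [eS SD sS]] := @ex_between _ e D l.+2 eD; first by rewrite se lD leqnSn.
by exists S => //; rewrite cl_subsets inE SD sS eqxx.
Qed.

(** All of [cl N] lies in the complete part on [D0], so the weight grows by exactly [wt N]. The
    complete part survives, so the step can be repeated with another point. *)
Lemma real_apex_subsets D D0 v l E z : D0 \subset D -> v \notin D ->
    subsets l.+2 D0 \subset E -> sets_on D l.+2 E -> pure E -> real D0 l.+1 z ->
  exists E', [/\ subsets l.+2 D0 \subset E', sets_on (v |: D) l.+2 E', pure E'
    & wt E' = (wt E + z)%R].
Proof.
move=> D0D vD D0E DE pE [N [D0N pN <-]]; have DN := onS D0D D0N.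
have clN : E :&: cl N = cl N.
  by apply/setIidPr/(subset_trans _ D0E)/cl_on_sub.
exists (apex v E N); split.
- by apply: subset_trans D0E (subsetUl _ _).
- exact: on_apex.
- apply: (pure_apex vD DE DN) => [e|e eE]; first by rewrite clN; apply: pN.
  by right; apply: pE.
- by rewrite (wt_apex vD DE DN) clN.
Qed.

Lemma cl_link v F : (forall Z, Z \in F -> v \in Z) -> cl F = set0.
Proof.
move=> vF; apply/setP=> X; rewrite in_set0; apply/negP=> /clP[/set0Pn[x xX] XF].
have vX : v \in X by have := vF _ (XF x xX); rewrite inE => /andP[].
by have := vF _ (XF v vX); rewrite !inE eqxx.
Qed.

(** [F] is a cover of [E] by members of [cl E]. Joining a point to [E] over [F] then gives weight
    [#|F| + #|E| - #|F|], that is [#|E|], and the cones over [F] form a new cover. *)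
Definition cone_system D l E F :=
  [/\ sets_on D l E, sets_on D l.+1 F, F \subset cl E, cl F = set0
    & forall e, e \in E -> exists2 Z, Z \in F & e \subset Z].

Lemma cone_systemS D v l E F : v \notin D -> cone_system D l E F ->
  let E' := apex v F E in let F' := [set v |: Z | Z in F] in
  [/\ cone_system (v |: D) l.+1 E' F', #|E'| = #|E| + #|F|, #|F'| = #|F|,
      pure E' & wt E' = #|E|%:Z%R].
Proof.
move=> vD [DE DF FE F0 EF] E' F'.
have vF Z := notin_on (X := Z) vD DF.
have cE' : cl E' = F'.
  apply/setP=> X; rewrite (mem_cl_apex _ vD DF DE) (setIidPl FE) F0 in_set0.
  case: ifPn => vX; last by apply/esym/imsetP => -[Z _ eX]; rewrite eX setU11 in vX.
  apply/idP/imsetP => [XF|[Z ZF ->]]; first by exists (X :\ v); rewrite ?setD1K.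
  by rewrite setU1K ?vF.
have sF' : #|F'| = #|F|.
  apply: card_in_imset => X Y /vF vX /vF vY /(congr1 (fun e => e :\ v)).
  by rewrite !setU1K.
have wE' : wt E' = #|E|%:Z%R.
  by rewrite (wt_apex vD DF DE) (setIidPl FE) /wt F0 cards0; lia.
have cov e : e \in E' -> exists2 Z, Z \in F' & e \subset Z.
  rewrite inE => /orP[eF|/imsetP[f /EF[Z ZF fZ] ->]].
    by exists (v |: e); rewrite ?subsetUr ?imset_f.
  by exists (v |: Z); rewrite ?setUS ?imset_f.
split=> //.
- split=> //.
  + exact: on_apex.
  + move=> X /imsetP[Z ZF ->]; have [ZD sZ] := DF _ ZF.
    by split; [apply: setUS|rewrite cardsU1 vF // sZ].
  + by rewrite cE'.
  + by apply: (@cl_link v) => X /imsetP[Z _ ->]; rewrite setU11.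
- by move: wE'; rewrite /wt cE' sF'; lia.
- by move=> e /cov[Z ZF' eZ]; exists Z; rewrite ?cE'.
Qed.

Definition singles D : {set {set T}} := [set [set x] | x in D].

Lemma card_singles D : #|singles D| = #|D|.
Proof. by rewrite card_imset //; apply: set1_inj. Qed.

Lemma on_singles D A : A \subset D -> sets_on D 1 (singles A).
Proof.
move=> AD e /imsetP[x xA ->]; rewrite cards1; split=> //.
by rewrite sub1set (subsetP AD).
Qed.

Lemma cl_singles D A E : sets_on D 2 E ->
  E :&: cl (singles A) = [set Z in E | Z \subset A].
Proof.
move=> DE; apply/setP=> Z; rewrite in_setI [RHS]inE; case: (boolP (Z \in E)) => //= /DE[_ sZ].
apply/clP/subsetP => [[_ ZA] x xZ|ZA].
  have [y] : exists y, y \in Z :\ x.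
    apply/set0Pn; rewrite -card_gt0.
    by move: (cardsD1 x Z); rewrite xZ sZ; lia.
  rewrite !inE => /andP[yx yZ].
  have /imsetP[t tA eZ] := ZA y yZ.
  have : x \in Z :\ y by rewrite !inE eq_sym yx.
  by rewrite eZ inE => /eqP->.
split=> [|x xZ]; first by rewrite -card_gt0 sZ.
have /cards1P[t et] : #|Z :\ x| == 1 by move: (cardsD1 x Z); rewrite xZ sZ; lia.
rewrite et imset_f // ZA //.
by have := set11 t; rewrite -et inE => /andP[].
Qed.

Lemma ex_edge_cover V : 1 < #|V| -> exists G : {set {set T}},
  [/\ G \subset subsets 2 V, #|G| <= uphalf #|V|
    & forall x, x \in V -> exists2 e, e \in G & x \in e].
Proof.
have pair x y : x \in V -> y \in V -> x != y -> [set x; y] \in subsets 2 V.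
  by move=> xV yV xy; rewrite inE subUset !sub1set xV yV cards2 xy.
move: {2}#|V| (leqnn #|V|) pair => m; elim: m V => [|m IHm] V; first lia.
move=> Vm pair V1.
have /card_gt1P[x [y [xV yV xy]]] := V1.
have sV : #|V| = #|V :\ x :\ y|.+2.
  by rewrite (cardsD1 x) xV (cardsD1 y (V :\ x)) !inE eq_sym xy yV.
have [V3|V2] := leqP 2 #|V :\ x :\ y|.
  have [||G [GV sG cG]] := IHm (V :\ x :\ y) _ _ V3; first lia.
    move=> a b; rewrite !inE => /and3P[ay ax aV] /and3P[bby bx bV] ab.
    by rewrite subUset !sub1set !inE ay ax aV bby bx bV cards2 ab.
  exists ([set x; y] |: G); split.
  - rewrite subUset sub1set pair //; apply: subset_trans GV _.
    apply/subsetP=> e; rewrite !inE => /andP[eV ->]; rewrite andbT.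
    by apply: subset_trans eV _; rewrite setDDl subsetDl.
  - rewrite cardsU1 sV; apply: (@leq_trans (1 + #|G|)); last exact: sG.
    by rewrite leq_add2r leq_b1.
  - move=> z zV; have [zx|zx] := eqVneq z x.
      by exists [set x; y]; rewrite ?setU11 // zx !inE eqxx.
    have [zy|zy] := eqVneq z y.
      by exists [set x; y]; rewrite ?setU11 // zy !inE eqxx orbT.
    have [|e eG ze] := cG z; first by rewrite !inE zx zy.
    by exists e => //; rewrite inE eG orbT.
have [V0|/set0Pn[z]] := eqVneq (V :\ x :\ y) set0.
  exists [set [set x; y]]; split.
  - by rewrite sub1set pair.
  - by rewrite cards1 sV.
  - move=> z zV; exists [set x; y]; rewrite ?set11 //.
    have : z \notin V :\ x :\ y by rewrite V0 inE.
    by rewrite !inE zV andbT orbC negb_and !negbK.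
rewrite !inE => /and3P[zy zx zV].
exists [set [set x; y]; [set x; z]]; split.
- by rewrite subUset !sub1set !pair // eq_sym.
- rewrite sV cards2 /=; have : 0 < #|V :\ x :\ y|; last by case: (_ != _); lia.
  by apply/card_gt0P; exists z; rewrite !inE zy zx.
- move=> t tV; have [tz|tz] := eqVneq t z.
    by exists [set x; z]; rewrite ?tz !inE eqxx ?orbT.
  exists [set x; y]; first by rewrite !inE eqxx.
  rewrite !inE; apply: contraT; rewrite negb_or => /andP[tx ty].
  have : 1 < #|V :\ x :\ y|; last by lia.
  by apply/card_gt1P; exists t, z; split; rewrite // !inE ?tx ?ty ?zx ?zy.
Qed.

(** [E] is a graph on [V] with [q] edges and no isolated vertex, plus all edges to [c]; [F] consists
    of the [q] triangles through [c]. *)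
Lemma cone_system2 V c q : 1 < #|V| -> c \notin V ->
  uphalf #|V| <= q <= 'C(#|V|, 2) -> exists E F,
  [/\ cone_system (c |: V) 2 E F, #|E| = #|V| + q & #|F| = q].
Proof.
move=> V1 cV /andP[e1 e2]; have [G0 [G0V sG0 cG0]] := ex_edge_cover V1.
have [|G [G0G GV sG]] := @ex_between _ _ _ q G0V.
  by rewrite card_subsets (leq_trans sG0).
have DG : sets_on V 2 G by move=> f /(subsetP GV)/on_subsets.
have DS := on_singles (subxx V).
have cG f := notin_on (X := f) cV DG.
exists (apex c G (singles V)), [set c |: f | f in G]; split.
- split.
  + exact: on_apex.
  + move=> X /imsetP[f fG ->]; have [fV sf] := DG _ fG.
    by split; [apply: setUS|rewrite cardsU1 cG // sf].
  + apply/subsetP=> X /imsetP[f fG ->].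
    rewrite (mem_cl_apex _ cV DG DS) setU11 setU1K ?cG // (cl_singles _ DG).
    by rewrite inE fG; case: (DG f fG).
  + by apply: (@cl_link c) => X /imsetP[Z _ ->]; rewrite setU11.
  + move=> f; rewrite inE => /orP[fG|/imsetP[g /imsetP[x xV ->] ->]].
      by exists (c |: f); rewrite ?subsetUr ?imset_f.
    have [h hG xh] := cG0 x xV; exists (c |: h); last by rewrite setUS ?sub1set.
    by rewrite imset_f // (subsetP G0G).
- by rewrite (card_apex cV DG DS) card_singles sG addnC.
- rewrite -sG; apply: card_in_imset => X Y /cG vX /cG vY /(congr1 (fun e => e :\ c)).
  by rewrite !setU1K.
Qed.

Lemma cone_systems V C q : 1 < #|V| -> [disjoint C & V] -> 0 < #|C| ->
  uphalf #|V| <= q <= 'C(#|V|, 2) -> exists E F,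
  [/\ cone_system (C :|: V) #|C|.+1 E F, #|E| = #|V| + #|C| * q & #|F| = q].
Proof.
move=> V1 CV C0 hq; move: {2}#|C| (erefl #|C|) => i.
elim: i C CV C0 => [|i IHi] C CV C0 iC; first by rewrite iC in C0.
have /card_gt0P[c cC] := C0.
have cV : c \notin V 
  by apply/negP => cV; move/pred0P: CV => /(_ c) /=; rewrite cC cV.
have eC : C = c |: (C :\ c) by rewrite setD1K.
have sC : #|C| = #|C :\ c|.+1 by rewrite (cardsD1 c) cC.
have [C1|C1] := posnP #|C :\ c|.
  have -> : C = [set c] by rewrite eC (cards0_eq C1) setU0.
  by rewrite cards1 mul1n; apply: cone_system2.
have disC : [disjoint C :\ c & V] by apply: disjointWl CV; apply: subsetDl.
have [|E [F [cEF sE sF]]] := IHi (C :\ c) disC C1.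
  by move: iC; rewrite sC => -[].
have cD : c \notin (C :\ c) :|: V by rewrite !inE eqxx.
have /= [cEF' sE' sF' _ _] := cone_systemS cD cEF.
exists (apex c F E), [set c |: Z | Z in F]; split.
- by rewrite setUA -eC -sC in cEF'.
- by rewrite sE' sE sF sC mulSn -!addnA [q + _]addnC.
- by rewrite sF'.
Qed.

Lemma real_cone D l r q : 1 < r -> l.+2 + r <= #|D| ->
  uphalf r <= q <= 'C(r, 2) -> real D l.+3 (r + l.+1 * q)%:Z.
Proof.
move=> r1 rD hq; have [V VD sV] := @ex_subset _ D r ltac:(lia).
have sDV : l.+2 <= #|D :\: V| by rewrite cardsD (setIidPr VD) sV; lia.
have [C CDV sC] := ex_subset sDV.
have [c cC] : exists c, c \in C by apply/card_gt0P; rewrite sC.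
have [CD disCV] : C \subset D /\ [disjoint C & V].
  by move: CDV; rewrite subsetD => /andP[].
have [||||E [F [cEF sE sF]]] := @cone_systems V (C :\ c) q; rewrite ?sV //.
- by apply: disjointWl disCV; apply: subsetDl.
- by move: (cardsD1 c C); rewrite cC sC; lia.
have cD : c \notin (C :\ c) :|: V.
  rewrite !inE eqxx /=; apply/negP => cV.
  by move/pred0P: disCV => /(_ c) /=; rewrite cC cV.
have sC1 : #|C :\ c| = l.+1 by move: (cardsD1 c C); rewrite cC sC add1n => -[].
have /= [[DE' _ _ _ _] _ _ pE' wE'] := cone_systemS cD cEF.
exists (apex c F E); split=> //; last by rewrite wE' sE sV sC1.
rewrite sC1 in DE'; apply: onS DE'.
by rewrite !subUset sub1set (subsetP CD) // VD (subset_trans (subsetDl _ _)).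
Qed.

End Recursion.

(** * Graphs *)

Lemma mul_bin2 n : 2 * 'C(n, 2) + n = n * n.
Proof. by elim: n => // n IHn; rewrite binS bin1; lia. Qed.

Section Graphs.
Variable T : finType.
Implicit Types (A C D V X Z e : {set T}) (E N F G M : {set {set T}}) (v x : T).

Definition vapex v E A := apex v E (singles A).

Section VertexApex.
Variables (D A : {set T}) (v : T) (E : {set {set T}}).
Hypotheses (vD : v \notin D) (DE : sets_on D 2 E) (AD : A \subset D).

Lemma on_vapex : sets_on (v |: D) 2 (vapex v E A).
Proof. exact: on_apex DE (on_singles AD) vD. Qed.

Lemma card_vapex : #|vapex v E A| = #|E| + #|A|.
Proof. by rewrite (card_apex vD DE (on_singles AD)) card_singles. Qed.

Lemma wt_vapex : wt (vapex v E A) =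
  (wt E + #|A|%:Z - #|[set Z in E | Z \subset A]|%:Z)%R.
Proof.
by rewrite (wt_apex vD DE (on_singles AD)) card_singles (cl_singles _ DE) addrA.
Qed.

Lemma pure_vapex :
  (forall x, x \in A -> exists2 Z, Z \in E & (x \in Z) && (Z \subset A)) ->
  (forall e, e \in E -> e \subset A \/ exists2 X, X \in cl E & e \subset X) ->
  pure (vapex v E A).
Proof.
move=> cA pE; apply: (pure_apex vD DE (on_singles AD)) => [e|e eE].
  move=> /imsetP[x /cA[Z ZE /andP[xZ ZA]] ->]; exists Z; last by rewrite sub1set.
  by rewrite (cl_singles _ DE) inE ZE.
case: (pE e eE) => [eA|]; [left|by right].
have : e \in [set Z in E | Z \subset A] by rewrite inE eE.
by rewrite -(cl_singles A DE) inE => /andP[].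
Qed.

Lemma sub_vapex Z : Z \subset D -> (Z \in vapex v E A) = (Z \in E).
Proof.
move=> ZD; rewrite (mem_apex _ vD DE (on_singles AD)) ifN //.
by apply: contra vD => /(subsetP ZD).
Qed.

End VertexApex.

(** * Positive weights from matchings *)

Lemma ex_matching V s : 2 * s <= #|V| ->
  exists M, [/\ sets_on V 2 M, trivIset M & #|M| = s].
Proof.
elim: s V => [|s IHs] V sV.
  exists set0; split; [by move=> e; rewrite inE| |by rewrite cards0].
  by apply/trivIsetP=> X Y; rewrite inE.
have /card_gt1P[x [y [xV yV xy]]] : 1 < #|V| by lia.
have sV2 : #|V| = #|V :\ x :\ y|.+2.
  by rewrite (cardsD1 x) xV (cardsD1 y (V :\ x)) !inE eq_sym xy yV.
have [|M [VM tM sM]] := IHs (V :\ x :\ y); first by move: sV; rewrite sV2; lia.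
have nM e : e \in M -> [disjoint [set x; y] & e].
  move=> /VM[eV _]; rewrite disjoint_sym disjoints_subset; apply: subset_trans eV _.
  by apply/subsetP=> z; rewrite !inE negb_or andbA => /andP[/andP[-> ->]].
exists ([set x; y] |: M); split.
- move=> e /setU1P[->|/VM[eV ->]].
    by rewrite subUset !sub1set xV yV cards2 xy.
  by split=> //; apply: subset_trans eV _; rewrite setDDl subsetDl.
- apply/trivIsetP=> X Y /setU1P[->|XM] /setU1P[->|YM] XY.
  + by rewrite eqxx in XY.
  + exact: nM.
  + by rewrite disjoint_sym nM.
  + by move/trivIsetP: tM; apply.
- rewrite cardsU1 sM; case: (boolP (_ \in M)) => // /nM.
  by move/pred0P/(_ x); rewrite /= !inE eqxx.
Qed.

Lemma cover_matching V M M' : sets_on V 2 M -> trivIset M -> M' \subset M ->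
  #|cover M'| = 2 * #|M'| /\ [set Z in M | Z \subset cover M'] = M'.
Proof.
move=> VM tM M'M; have tM' : trivIset M' by apply: trivIsetS tM.
split.
  rewrite -(eqP tM') (eq_bigr (fun=> 2)) ?sum_nat_const 1?mulnC //.
  by move=> Z /(subsetP M'M)/VM[].
apply/setP=> Z; rewrite inE; apply/andP/idP => [[ZM ZM']|ZM']; last first.
  by rewrite (subsetP M'M) // bigcup_sup.
have /set0Pn[x xZ] : Z != set0 by rewrite -card_gt0 (VM Z ZM).2.
have /bigcupP[Z' Z'M xZ'] := subsetP ZM' x xZ.
suff -> : Z = Z' by [].
apply/eqP; apply: contraT => ZZ'.
have /pred0P/(_ x) := trivIsetP tM Z Z' ZM (subsetP M'M _ Z'M) ZZ'.
by rewrite /= xZ xZ'.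
Qed.

Lemma cl_matching V M : sets_on V 2 M -> trivIset M -> cl M = set0.
Proof.
move=> VM tM; apply/setP=> X; rewrite in_set0; apply/negP=> XM.
have /card_gt2P[x [y [z [[xX yX zX] [xy yz zx]]]]] : 2 < #|X|.
  by rewrite (card_cl VM XM).
have [_ XE] := clP _ _ XM.
have : X :\ x != X :\ y.
  apply/eqP=> /setP/(_ x); rewrite !inE eqxx xX xy.
  by [].
move/(trivIsetP tM _ _ (XE x xX) (XE y yX))/pred0P/(_ z).
by rewrite /= !inE zx eq_sym yz zX.
Qed.

(** A first vertex joined to all [s] matching edges puts each in a triangle and gives weight
    [2 * s]; every further one, joined to both ends of [r] matching edges, adds [2 r - r]. *)
Lemma real_low D s z : 0 < s -> 2 * s < #|D| ->
  2 * s <= z <= s * (#|D| - 2 * s).+1 -> real D 2 z%:Z.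
Proof.
move=> s0 sD hz.
suff: exists V M E, [/\ [/\ V \subset D, sets_on V 2 M, trivIset M & #|M| = s],
    [/\ sets_on D 2 E, pure E & wt E = z%:Z%R] &
    (* Invariant: added vertices create no edge inside [V], so a new vertex closes triangles only
       with matching edges. *)
    forall Z, Z \subset V -> (Z \in E) = (Z \in M)].
  by move=> [V [M [E [_ [DE pE wE] _]]]]; exists E.
have := erefl (#|D| - (2 * s).+1); move: {2}(#|D| - _) => j.
elim: j D z sD hz => [|j IHj] D z sD hz jD; last first.
  have /card_gt0P[v vD] : 0 < #|D| by lia.
  have sDv : #|D| = #|D :\ v|.+1 by rewrite (cardsD1 v) vD.
  have vDv : v \notin D :\ v by rewrite !inE eqxx.
  have d1 : 0 < #|D :\ v| - 2 * s by move: jD; rewrite sDv; lia.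
  rewrite sDv subSn in hz; last by move: d1; lia.
  move: (#|D :\ v| - 2 * s) d1 hz (IHj (D :\ v)) => d d1 hz IHD.
  have [r [z' [ez rs hz']]] : exists r z', [/\ z = z' + r, r <= s &
      2 * s <= z' <= s * d.+1].
    rewrite !mulnS in hz *; have sd : s <= s * d by rewrite leq_pmulr.
    have [zs|zs] := leqP z (3 * s).
      by exists (z - 2 * s), (2 * s); split; lia.
    by exists s, (z - s); split; lia.
  have [||V [M [E [[VD VM tM sM] [DE pE wE] EM]]]] := IHD z' _ hz'.
  - by move: jD; rewrite sDv; lia.
  - by move: jD; rewrite sDv; lia.
  have [M' M'M sM'] : exists2 M' : {set {set T}}, M' \subset M & #|M'| = r.
    by apply: ex_subset; rewrite sM.
  have [cM' inM'] := cover_matching VM tM M'M.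
  have M'V : cover M' \subset V.
    by apply/bigcupsP=> Z /(subsetP M'M)/VM[].
  have M'D := subset_trans M'V VD.
  have inE' : [set Z in E | Z \subset cover M'] = M'.
    rewrite -[RHS]inM'; apply/setP=> Z; rewrite [LHS]inE [RHS]inE.
    case: (boolP (Z \subset _)) => [ZM|]; last by rewrite !andbF.
    by rewrite !andbT EM // (subset_trans ZM).
  exists V, M, (vapex v E (cover M')); split; first split=> //.
  - by apply: subset_trans VD _; apply: subsetDl.
  - split; first by rewrite -[D](setD1K vD); apply: on_vapex.
      apply: (pure_vapex vDv DE M'D) => [x /bigcupP[Z ZM xZ]|e eE].
        exists Z; first by move: ZM; rewrite -{1}inE' inE => /andP[].
        by rewrite xZ bigcup_sup.
      by right; apply: pE.
    by rewrite (wt_vapex vDv DE M'D) wE inE' cM' sM' ez; lia.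
  - by move=> Z ZV; rewrite (sub_vapex vDv DE M'D) ?EM // (subset_trans ZV).
have {jD hz} [sD1 ez] : #|D| = (2 * s).+1 /\ z = 2 * s.
  have eD : #|D| = (2 * s).+1 by lia.
  by split=> //; move: hz; rewrite eD subSn // subnn; lia.
have /card_gt0P[v vD] : 0 < #|D| by lia.
have sDv : #|D :\ v| = 2 * s.
  by move: (cardsD1 v D); rewrite vD sD1 add1n => -[].
have vDv : v \notin D :\ v by rewrite !inE eqxx.
have [M [VM tM sM]] := ex_matching (eq_leq (esym sDv)).
have [cM inM] := cover_matching VM tM (subxx M).
have eV : cover M = D :\ v.
  apply/eqP; rewrite eqEcard cM sM sDv leqnn andbT.
  by apply/bigcupsP=> Z /VM[].
rewrite eV in inM.
exists (D :\ v), M, (vapex v M (D :\ v)); split; first by split=> //; apply: subsetDl.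
  split; first by rewrite -{1}[D](setD1K vD); apply: on_vapex.
    apply: (pure_vapex vDv VM (subxx _)) => [x|e /VM[]]; last by left.
    rewrite -{1}eV => /bigcupP[Z ZM xZ]; exists Z => //; rewrite xZ.
    by case: (VM Z ZM).
  by rewrite (wt_vapex vDv VM (subxx _)) inM /wt (cl_matching VM tM) cards0 sM sDv ez; lia.
by move=> Z ZV; rewrite (sub_vapex vDv VM (subxx _)).
Qed.

(** * Nearly complete graphs *)

Lemma wt_subsets D l :
  wt (subsets l.+1 D) = ('C(#|D|, l.+1)%:Z - 'C(#|D|, l.+2)%:Z)%R.
Proof. by rewrite /wt cl_subsets !card_subsets. Qed.

Lemma sub_subsets l A D : A \subset D ->
  [set Z in subsets l D | Z \subset A] = subsets l A.
Proof.
move=> AD; apply/setP=> Z; rewrite !inE andbC.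
by case: (boolP (Z \subset A)) => //= ZA; rewrite (subset_trans ZA AD).
Qed.

Lemma ex_pair A x : x \in A -> 1 < #|A| ->
  exists2 Z, Z \in subsets 2 A & x \in Z.
Proof.
move=> xA A1; have [||Z [xZ ZA sZ]] := @ex_between _ [set x] A 2.
- by rewrite sub1set.
- by rewrite cards1.
by exists Z; rewrite ?inE ?ZA ?sZ // -sub1set.
Qed.

(* Two adjacent vertices [v] and [u] on top of a complete graph [K]: [v] is
   joined to [t] vertices, [u] to [v] and to [a] vertices of [K], [g] of which
   are neighbours of [v]. *)
Lemma real_double D t a g : 1 < t -> 1 < a -> 0 < g ->
    g <= a -> g <= t -> t + a <= #|D| - 2 + g -> 4 < #|D| ->
  real D 2 ('C(#|D| - 2, 2)%:Z - 'C(#|D| - 2, 3)%:Z + (t%:Z - 'C(t, 2)%:Z)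
            + (a%:Z + 1 - 'C(a, 2)%:Z - g%:Z))%R.
Proof.
move=> t1 a1 g0 ga gt tag D4.
have [v vD] : exists v, v \in D by apply/card_gt0P; lia.
have [u uD] : exists u, u \in D :\ v.
  by apply/card_gt0P; move: (cardsD1 v D); rewrite vD; lia.
set K := D :\ v :\ u.
have sK : #|D| = #|K|.+2 by rewrite (cardsD1 v) vD (cardsD1 u (D :\ v)) uD.
rewrite sK subn2 /= in tag *.
have K3 : 2 < #|K| by rewrite sK in D4.
have [S SK sS] : exists2 S : {set T}, S \subset K & #|S| = t.
  by apply: ex_subset; lia.
have [B BS sB] : exists2 B : {set T}, B \subset S & #|B| = g.
  by apply: ex_subset; rewrite sS.
have [C CKS sC] : exists2 C : {set T}, C \subset K :\: S & #|C| = a - g.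
  by apply: ex_subset; rewrite cardsD (setIidPr SK) sS; lia.
have [CK CS] : C \subset K /\ [disjoint C & S].
  by move: CKS; rewrite subsetD => /andP[].
pose A := B :|: C.
have BK := subset_trans BS SK.
have AK : A \subset K by rewrite subUset BK.
have sA : #|A| = a.
  rewrite cardsU sB sC (_ : B :&: C = set0) ?cards0 ?subn0 ?subnKC //.
  by apply/disjoint_setI0; rewrite disjoint_sym; apply: disjointWr CS.
have AS : A :&: S = B.
  by rewrite setIUl (setIidPl BS) (disjoint_setI0 CS) setU0.
have vK : v \notin K by rewrite !inE eqxx !andbF.
have uvK : u \notin v |: K.
  by move: uD; rewrite !inE eqxx /= => /andP[/negbTE->].
have uvD : u |: (v |: K) = D.
  rewrite setUCA /K setD1K // setUC -{2}(setD1K vD) setUC; congr (_ |: _).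
have K0 := @on_subsets _ 2 K.
set E1 := vapex v (subsets 2 K) S.
have E1K : sets_on (v |: K) 2 E1 := on_vapex vK K0 SK.
have AvK : v |: A \subset v |: K by rewrite setUS.
have vA : v \notin A by apply: contra vK => /(subsetP AK).
(* The triangles closed by [u] correspond to these edges: all pairs in [A], and [v] with each common
   neighbour in [B]. *)
have EA : [set Z in E1 | Z \subset v |: A] = vapex v (subsets 2 A) B.
  apply/setP=> Z; rewrite inE.
  rewrite (mem_apex _ vK K0 (on_singles SK)).
  rewrite (mem_apex _ vA (@on_subsets _ 2 A) (on_singles (subsetUl B C))).
  case: ifPn => vZ.
    apply/andP/imsetP => [[/imsetP[x xS eZ] ZA]|[x xB eZ]].
      exists x => //; rewrite -AS inE xS andbT.
      have : x \in Z :\ v by rewrite eZ inE.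
      rewrite !inE => /andP[xv xZ].
      by have := subsetP ZA x xZ; rewrite !inE (negbTE xv).
    split; first by apply/imsetP; exists x => //; apply: (subsetP BS).
    by rewrite -(setD1K vZ) setUS // eZ sub1set inE xB.
  rewrite -(sub_subsets 2 AK) [RHS]inE; congr (_ && _).
  apply/idP/idP => [ZA|]; last by move/subset_trans; apply; apply: subsetUr.
  apply/subsetP=> x xZ; have := subsetP ZA x xZ.
  by rewrite in_setU1 => /orP[/eqP xv|//]; rewrite -xv xZ in vZ.
have pE1 : pure E1.
  apply: (pure_vapex vK K0 SK) => [x xS|e eK].
    have [|Z ZS xZ] := ex_pair xS; first by rewrite sS.
    move: ZS; rewrite inE => /andP[ZS sZ]; exists Z; last by rewrite xZ.
    by rewrite inE (subset_trans ZS SK).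
  by right; apply: (pure_subsets K3).
exists (vapex u E1 (v |: A)); split.
- by rewrite -uvD; apply: on_vapex.
- apply: (pure_vapex uvK E1K AvK) => [x|e]; last by right; apply: pE1.
  rewrite in_setU1 => /orP[/eqP->|xA].
    have /card_gt0P[y yB] : 0 < #|B| by rewrite sB.
    exists (v |: [set y]); last first.
      by rewrite setU11 setUS // sub1set inE yB.
    by rewrite inE imset_f ?orbT // imset_f // (subsetP BS).
  have [|Z ZA xZ] := ex_pair xA; first by rewrite sA.
  rewrite -(sub_subsets 2 AK) inE in ZA; case/andP: ZA => ZK ZA.
  exists Z; first by rewrite (sub_vapex vK K0 SK) //; case: (K0 _ ZK).
  by rewrite xZ (subset_trans ZA) ?subsetUr.
- rewrite (wt_vapex uvK E1K AvK) EA (card_vapex vA (@on_subsets _ 2 A) (subsetUl B C)).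
  rewrite (wt_vapex vK K0 SK) wt_subsets sub_subsets // !card_subsets sA sB sS.
  by rewrite cardsU1 vA sA add1n; clear; lia.
Qed.

(* [star_forest i m p d]: the complete graph on [i] vertices minus [m] edges
   forming a star and disjoint paths; [p] counts the pairs of adjacent missing
   edges, and [d] is the number of missing edges at the vertex [z] added last. *)
Definition star_forest i m p d := forall D, #|D| = i -> exists E z,
  [/\ sets_on D 2 E, forall x, x \in D -> exists2 Z, Z \in E & x \in Z,
      z \in D /\ #|[set Z in E | z \in Z]| + d.+1 = i,
      #|E| + m = 'C(i, 2)
    & wt E = ('C(i, 2)%:Z - 'C(i, 3)%:Z + m%:Z * (i%:Z - 3) - p%:Z)%R].

Lemma on_full D E : sets_on D 2 E -> [set Z in E | Z \subset D] = E.
Proof.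
by move=> DE; apply/setP=> Z; rewrite inE andb_idr // => /DE[].
Qed.

Lemma deg_vapex D v E A : v \notin D -> sets_on D 2 E -> A \subset D ->
  #|[set Z in vapex v E A | v \in Z]| = #|A|.
Proof.
move=> vD DE AD; rewrite (@card_split _ v _ set0 (singles A)) => [|X|X|X].
- by rewrite cards0 card_singles.
- rewrite [LHS]inE (mem_apex _ vD DE (on_singles AD)).
  by case: ifP => vX; rewrite ?andbT // andbF inE.
- by rewrite inE.
- exact: notin_on vD (on_singles AD).
Qed.

Lemma star_forest_full i m p d : 0 < i ->
  star_forest i m p d -> star_forest i.+1 m p 0.
Proof.
move=> i0 S D sD; have /card_gt0P[v vD] : 0 < #|D| by rewrite sD.
have sDv : #|D :\ v| = i by move: (cardsD1 v D); rewrite vD sD add1n => -[].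
have vDv : v \notin D :\ v by rewrite !inE eqxx.
have [E [z [DE cE [zD dz] sE wE]]] := S _ sDv.
exists (vapex v E (D :\ v)), v; split.
- by rewrite -{1}[D](setD1K vD); apply: (on_vapex vDv DE (subxx _)).
- move=> x xD; have [->|xv] := eqVneq x v; last first.
    have [|Z ZE xZ] := cE x; first by rewrite !inE xv.
    by exists Z => //; rewrite inE ZE.
  exists (v |: [set z]); last exact: setU11.
  by rewrite inE imset_f ?orbT // imset_f.
- by split=> //; rewrite (deg_vapex vDv DE (subxx _)) sDv addn1.
- by rewrite (card_vapex vDv DE (subxx _)) sDv binS bin1; lia.
- by rewrite (wt_vapex vDv DE (subxx _)) (on_full DE) wE sDv !binS bin1 ?bin0 -sE; lia.
Qed.

(** The new missing edge joins [v] to [z] and so is adjacent to the [d] edges already missing at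
    [z]. *)
Lemma star_forest_edge i m p d : 1 < i ->
  star_forest i m p d -> star_forest i.+1 m.+1 (p + d) 1.
Proof.
move=> i0 S D sD; have /card_gt0P[v vD] : 0 < #|D| by rewrite sD.
have sDv : #|D :\ v| = i by move: (cardsD1 v D); rewrite vD sD add1n => -[].
have vDv : v \notin D :\ v by rewrite !inE eqxx.
have [E [z [DE cE [zD dz] sE wE]]] := S _ sDv.
have AD : D :\ v :\ z \subset D :\ v by apply: subsetDl.
have sA : #|D :\ v :\ z|.+1 = i.
  by move: (cardsD1 z (D :\ v)); rewrite zD sDv add1n.
have sEz : #|[set Z in E | Z \subset D :\ v :\ z]| +
    #|[set Z in E | z \in Z]| = #|E|.
  rewrite addnC -(cardsID [set Z : {set T} | z \in Z] E); congr (_ + _).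
    by apply: eq_card => Z; rewrite !inE.
  apply: eq_card => Z; rewrite [LHS]inE [RHS]inE andbC inE subsetD1.
  by case: (boolP (Z \in E)) => [/DE[-> _]|]; rewrite ?andbT ?andbF.
exists (vapex v E (D :\ v :\ z)), v; split.
- by rewrite -{1}[D](setD1K vD); apply: (on_vapex vDv DE AD).
- move=> x xD; have [->|xv] := eqVneq x v; last first.
    have [|Z ZE xZ] := cE x; first by rewrite !inE xv.
    by exists Z => //; rewrite inE ZE.
  have /card_gt0P[y yA] : 0 < #|D :\ v :\ z| by lia.
  exists (v |: [set y]); last exact: setU11.
  by rewrite inE imset_f ?orbT // imset_f.
- by split=> //; rewrite (deg_vapex vDv DE AD); lia.
- by rewrite (card_vapex vDv DE AD) binS bin1; lia.
- by rewrite (wt_vapex vDv DE AD) wE !binS bin1 ?bin0; nia.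
Qed.

(** The vertex outside [S] and [v] is the centre of the missing star. [v] keeps all its edges, so
    the next missing edge is disjoint from the star. *)
Lemma star_forest0 s : star_forest s.+2 s 'C(s, 2) 0.
Proof.
move=> D sD; have /card_gt0P[v vD] : 0 < #|D| by rewrite sD.
have sDv : #|D :\ v| = s.+1 by move: (cardsD1 v D); rewrite vD sD add1n => -[].
have vDv : v \notin D :\ v by rewrite !inE eqxx.
have [S SD sS] : exists2 S : {set T}, S \subset D :\ v & #|S| = s.
  by apply: ex_subset; rewrite sDv.
have DE : sets_on (D :\ v) 2 (subsets 2 S) := onS SD (@on_subsets _ 2 S).
exists (vapex v (subsets 2 S) (D :\ v)), v; split.
- by rewrite -{1}[D](setD1K vD); apply: (on_vapex vDv DE (subxx _)).
- have vE y : y \in D :\ v -> v |: [set y] \in vapex v (subsets 2 S) (D :\ v).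
    by move=> yD; rewrite inE imset_f ?orbT // imset_f.
  move=> x xD; have [->|xv] := eqVneq x v; last first.
    by exists (v |: [set x]); rewrite ?vE ?inE ?xv // eqxx orbT.
  have /card_gt0P[y yA] : 0 < #|D :\ v| by rewrite sDv.
  by exists (v |: [set y]); rewrite ?vE ?setU11.
- by split=> //; rewrite (deg_vapex vDv DE (subxx _)) sDv addn1.
- by rewrite (card_vapex vDv DE (subxx _)) card_subsets sS sDv !binS bin1 ?bin0; lia.
- rewrite (wt_vapex vDv DE (subxx _)) (on_full DE) wt_subsets card_subsets sS sDv !binS bin1 ?bin0.
  move: ('C(s, 3)) ('C(s, 2)) (mul_bin2 s) => b3 b2; clear; nia.
Qed.

(** A last vertex joined to everything puts every edge in a triangle. *)
Lemma real_star_forest D i m p d : star_forest i m p d -> #|D| = i.+1 -> 0 < i ->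
  real D 2 ('C(i.+1, 2)%:Z - 'C(i.+1, 3)%:Z + m%:Z * (i%:Z - 2) - p%:Z)%R.
Proof.
move=> S sD i0; have /card_gt0P[v vD] : 0 < #|D| by rewrite sD.
have sDv : #|D :\ v| = i by move: (cardsD1 v D); rewrite vD sD add1n => -[].
have vDv : v \notin D :\ v by rewrite !inE eqxx.
have [E [z [DE cE [zD dz] sE wE]]] := S _ sDv.
exists (vapex v E (D :\ v)); split.
- by rewrite -{1}[D](setD1K vD); apply: (on_vapex vDv DE (subxx _)).
- apply: (pure_vapex vDv DE (subxx _)) => [x /cE[Z ZE xZ]|e /DE[]]; last by left.
  by exists Z; rewrite ?xZ //; case: (DE Z ZE).
- by rewrite (wt_vapex vDv DE (subxx _)) (on_full DE) wE sDv !binS bin1 ?bin0 -sE; lia.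
Qed.

End Graphs.

Local Open Scope ring_scope.

(** * Ranges of weights *)

Definition realizable n l (z : int) :=
  forall (T : finType) (D : {set T}), (n <= #|D|)%N -> real D l z.

(** The weight of the complete l-graph on [n] points, for positive [l]. *)
Definition bdiff n l : int := 'C(n, l)%:Z - 'C(n, l.+1)%:Z.

Lemma realizable_exact n l z :
  (forall (T : finType) (D : {set T}), #|D| = n -> real D l z) ->
  realizable n l z.
Proof.
move=> H T D /ex_subset[S SD sS]; apply: real_sub SD _; exact: H.
Qed.

Lemma realizable_mono n n' l z : (n <= n')%N -> realizable n l z ->
  realizable n' l z.
Proof. by move=> nn' H T D /(leq_trans nn')/H. Qed.

Lemma bdiffS n l : bdiff n.+1 l.+1 = bdiff n l.+1 + bdiff n l.
Proof. by rewrite /bdiff !binS; lia. Qed.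

Lemma mul_bin3 n : (6 * 'C(n, 3) + 3 * (n * n) = n * n * n + 2 * n)%N.
Proof. by elim: n => // n IHn; rewrite binS; have := mul_bin2 n; lia. Qed.

Lemma mul_bin4 n :
  (24 * 'C(n.+4, 4) = (n + 4) * (n + 3) * (n + 2) * (n + 1))%N.
Proof.
elim: n => // n IHn; rewrite binS mulnDr IHn.
have := mul_bin3 n.+4; lia.
Qed.

Lemma bdiff2 n : 6 * bdiff n 2 = n%:Z * (n%:Z - 1) * (5 - n%:Z).
Proof. by rewrite /bdiff; have := mul_bin2 n; have := mul_bin3 n; lia. Qed.

Lemma bdiff_mid l : bdiff (2 * l + 1) l = 0.
Proof.
rewrite /bdiff -(@bin_sub (2 * l + 1) l); last lia.
by rewrite (_ : 2 * l + 1 - l = l.+1)%N ?subrr //; lia.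
Qed.

(** The two binomials have ratio [(m + 3) / (m + 1)], so their difference is [2 / (m + 1)] times the
    smaller one, which is at least ['C(m + 4, 4)]. *)
Lemma bdiff_below_mid m : (3 <= m)%N ->
  bdiff (2 * m + 3) m + 'C(m + 3, 2)%:Z <= 0.
Proof.
move=> m3; rewrite /bdiff.
have E : (m.+1 * 'C(2 * m + 3, m.+1) = (m + 3) * 'C(2 * m + 3, m))%N.
  rewrite mul_bin_left; congr (_ * _)%N; lia.
have B : ('C(m.+4, 4) <= 'C(2 * m + 3, m))%N.
  rewrite -(@bin_sub m.+4 4) //; apply: leq_trans (_ : 'C(m.+4, m) <= _)%N.
    by rewrite !subSS subn0.
  by apply: leq_bin2l; lia.
have := mul_bin4 m; have := mul_bin2 (m + 3).
move: ('C(m.+4, 4)) ('C(2 * m + 3, m.+1)) ('C(2 * m + 3, m)) ('C(m + 3, 2)) E B.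
move=> b4 x y b2 E B E2 E4.
have B2 : ((m.+1 * (4 * b2 + 4 * y)) <= m.+1 * (4 * x))%N; last first.
  by rewrite leq_pmul2l // in B2; lia.
have Eb : (2 * b2 = (m + 3) * (m + 2))%N by lia.
have -> : (m.+1 * (4 * b2 + 4 * y) = 2 * m.+1 * (2 * b2) + 4 * m.+1 * y)%N by lia.
have -> : (m.+1 * (4 * x) = 4 * ((m + 3) * y))%N by lia.
rewrite Eb.
have : (24 * y >= (m + 4) * (m + 3) * (m + 2) * (m + 1))%N by lia.
have : ((m + 4) * (m + 3) * (m + 2) * (m + 1) >= 6 * ((m + 3) * (m + 2) * (m + 1)))%N by nia.
lia.
Qed.

Lemma realizable_apex c l z : (l.+2 < c)%N -> realizable c l.+1 z ->
  realizable c.+1 l.+2 (bdiff c l.+2 + z).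
Proof.
move=> lc H; apply: realizable_exact => T D sD.
have /card_gt0P[v vD] : (0 < #|D|)%N by rewrite sD.
have sDv : #|D :\ v| = c by move: (cardsD1 v D); rewrite vD sD add1n => -[].
have vDv : v \notin D :\ v by rewrite !inE eqxx.
have K3 : (l.+2 < #|D :\ v|)%N by rewrite sDv.
have [E [_ DE pE wE]] := real_apex_subsets (subxx _) vDv (subxx _)
  (@on_subsets _ _ _) (pure_subsets K3) (H T (D :\ v) (eq_leq (esym sDv))).
by exists E; rewrite setD1K // in DE; split=> //; rewrite wE wt_subsets sDv.
Qed.

(** Both new points are joined to families on the same [c] points and never occur together, so the
    weights add. *)
Lemma realizable_apex2 c l z1 z2 : (l.+2 < c)%N ->
  realizable c l.+1 z1 -> realizable c l.+1 z2 ->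
  realizable c.+2 l.+2 (bdiff c l.+2 + z1 + z2).
Proof.
move=> lc H1 H2; apply: realizable_exact => T D sD.
have /card_gt0P[v vD] : (0 < #|D|)%N by rewrite sD.
have sDv : #|D :\ v| = c.+1 by move: (cardsD1 v D); rewrite vD sD add1n => -[].
have vDv : v \notin D :\ v by rewrite !inE eqxx.
have /card_gt0P[u uD] : (0 < #|D :\ v|)%N by rewrite sDv.
have sDu : #|D :\ v :\ u| = c.
  by move: (cardsD1 u (D :\ v)); rewrite uD sDv add1n => -[].
have uDu : u \notin D :\ v :\ u by rewrite !inE eqxx.
have K3 : (l.+2 < #|D :\ v :\ u|)%N by rewrite sDu.
have [E [KE DE pE wE]] := real_apex_subsets (subxx _) uDu (subxx _)
  (@on_subsets _ _ _) (pure_subsets K3) (H1 T (D :\ v :\ u) (eq_leq (esym sDu))).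
rewrite setD1K // in DE.
have [E' [_ DE' pE' wE']] := real_apex_subsets (subsetDl (D :\ v) [set u]) vDv KE
  DE pE (H2 T (D :\ v :\ u) (eq_leq (esym sDu))).
by exists E'; rewrite setD1K // in DE'; split=> //; rewrite wE' wE wt_subsets sDu.
Qed.

(** Order of construction: the star, an edge apart from it, [b] edges prolonging that edge to a
    path, [r] separate edges, and [j] vertices joined to everything. *)
Lemma star_forest_params (T : finType) s b r j :
  exists d, star_forest T (s + 3 + b + 2 * r + j) (s + 1 + b + r) ('C(s, 2) + b) d.
Proof.
elim: j => [|j [d IHj]]; last first.
  by exists 0%N; rewrite addnS; apply: star_forest_full IHj; lia.
rewrite addn0; suff H : star_forest T (s + 3 + b + 2 * r) (s + 1 + b + r) ('C(s, 2) + b) 1.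
  by exists 1%N.
elim: r => [|r IHr]; last first.
  have i0 : (0 < s + 3 + b + 2 * r)%N by lia.
  have i1 : (1 < (s + 3 + b + 2 * r).+1)%N by lia.
  have := star_forest_edge i1 (star_forest_full i0 IHr).
  by congr (star_forest _ _ _ _ _); lia.
elim: b => [|b IHb].
  have := star_forest_edge (isT : (1 < s.+2)%N) (@star_forest0 T s).
  by congr (star_forest _ _ _ _ _); lia.
have i1 : (1 < s + 3 + b + 2 * 0)%N by lia.
have := star_forest_edge i1 IHb.
by congr (star_forest _ _ _ _ _); lia.
Qed.

Lemma realizable_graph_top n w : (6 <= n)%N ->
  bdiff n.-1 2 + 1 <= w -> w <= bdiff n.-2 2 -> w <= 1 -> realizable n 2 w.
Proof.
move=> n6 w1 w2 w3; apply: realizable_exact => T D sD.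
have [k en] : exists k, n = k.+3 by exists (n - 3)%N; lia.
have k3 : (3 <= k)%N by lia.
rewrite en /= in w1 w2.
have := bdiff2 k.+3; have := bdiff2 k.+2; have := bdiff2 k.+1.
move=> V1 V2 V3.
have wy : 0 <= w - bdiff k.+3 2 by nia.
have [y ey] : exists y : nat, w = bdiff k.+3 2 + y%:Z.
  by exists `|w - bdiff k.+3 2|%N; rewrite gez0_abs //; lia.
have [||||[s [b [r [hr ey2]]]]|[t [a [g [t1 [a1 [g1 [ga [gt [tag ey2]]]]]]]]]]
  := spans_nat k y.
- lia.
- lia.
- lia.
- lia.
- have [j ej] : exists j, (s + 3 + b + 2 * r + j = k.+2)%N.
    by exists (k.+2 - (s + 3 + b + 2 * r))%N; lia.
  have [d S] := star_forest_params T s b r j.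
  rewrite ej in S; have := real_star_forest (D := D) S.
  rewrite sD en => /(_ erefl isT).
  congr (real _ _ _); rewrite ey /bdiff; have := mul_bin2 s.
  by move: ('C(s, 2)) ey2 => b2 ey2 eb; lia.
- have := @real_double T D t a g; rewrite sD en.
  rewrite subSS subSS subn0 => H.
  have /H : (1 < t)%N by lia.
  have A1 : (1 < a)%N by lia.
  have G0 : (0 < g)%N by lia.
  have GA : (g <= a)%N by lia.
  have GT : (g <= t)%N by lia.
  have TAG : (t + a <= k.+1 + g)%N by lia.
  move=> /(_ A1 G0 GA GT TAG) {}H.
  have /H : (4 < k.+3)%N by lia.
  congr (real _ _ _).
  rewrite -/(bdiff k.+1 2) ey; have := mul_bin2 t; have := mul_bin2 a.
  by move: ('C(t, 2)) ('C(a, 2)) ey2 => b2 b3 ey2 eb eb'; nia.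
Qed.

Lemma realizable_low n s z : (0 < s)%N -> (2 * s < n)%N ->
  (2 * s <= z <= s * (n - 2 * s).+1)%N -> realizable n 2 z%:Z.
Proof.
move=> s0 sn hz; apply: realizable_exact => T D sD.
by apply: (@real_low T D s z); rewrite ?sD.
Qed.

(** One matching edge covers the weights below [n]; from [n] on, the best matching size is used. *)
Lemma realizable_graph_low n z : (5 <= n)%N -> (2 <= z)%N ->
  (8 * z <= (n + 1) ^ 2)%N -> realizable n 2 z%:Z.
Proof.
move=> n5 z2 zn; have [zn1|zn1] := ltnP z n.
  by apply: (@realizable_low n 1); lia.
have [s [s0 sn sz]] : exists s, [/\ (0 < s)%N, (4 * s <= n + 2)%N &
    ((n + 1) ^ 2 < 8 * (s * (n - 2 * s).+1).+1)%N].
  (* An integer nearest to [(n + 1) / 4], where [s (n + 1 - 2 s)] is largest. *)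
  exists ((n + 2) %/ 4)%N.
  have := divn_eq (n + 2) 4; have := ltn_pmod (n + 2) (isT : 0 < 4)%N.
  move: ((n + 2) %/ 4)%N ((n + 2) %% 4)%N => s i i4 En.
  have en : n = (4 * s + i - 2)%N by lia.
  move=> {En}; case: i i4 en => [|[|[|[|//]]]] _ en; rewrite en in n5 *; split; clear -n5; lia.
by apply: (@realizable_low n s); lia.
Qed.

(** Below 2, the interval of [realizable_graph_top] on [n] vertices ends just where the range on
    [n - 1] vertices begins. *)
Lemma realizable_graph n w : (5 <= n)%N ->
  bdiff n.-1 2 + 1 <= w -> 8 * w <= (n%:Z + 1) ^+ 2 -> realizable n 2 w.
Proof.
elim: n w => // n IHn w n5 w1 w2; have [w3|w3] := leP 2 w.
  have ew : w = `|w|%N%:Z by rewrite gez0_abs //; lia.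
  by rewrite ew; apply: realizable_graph_low => //; lia.
rewrite leq_eqVlt in n5; case/orP: n5 => [/eqP en|n5].
  have := bdiff2 4; rewrite -{}en /= in w1 *; lia.
have [w4|w4] := leP w (bdiff n.-1 2).
  by apply: realizable_graph_top => //; lia.
apply: (realizable_mono (leqnSn n)); apply: IHn => //; first by lia.
by nia.
Qed.

Lemma realizable_cone n l r q : (1 < r)%N -> (l.+2 + r <= n)%N ->
  (uphalf r <= q <= 'C(r, 2))%N -> realizable n l.+3 (r + l.+1 * q)%:Z.
Proof.
move=> r1 rn hq; apply: realizable_exact => T D sD.
by apply: real_cone; rewrite ?sD.
Qed.

(* [n = 2 l + j + 7] at level [l + 3], so the cones have [j + 5] to [j + 5 + l]
   base points. *)
Lemma realizable_cone_range l j w : (2 <= j)%N ->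
    (l + 3 <= j * j + 7 * j + 14)%N ->
    ('C(j + l + 4, 2) <= w)%N -> (w < 'C(j + l + 5, 2))%N ->
  realizable (2 * l + j + 7) l.+3 w%:Z.
Proof.
move=> j2 lj w1 w2.
have e4 := mul_bin2 (j + l + 4); have e5 := mul_bin2 (j + l + 5).
have W1 : ((j + l + 4) * (j + l + 3) <= 2 * w)%N by lia.
have W2 : (2 * w + 2 <= (j + l + 5) * (j + l + 4))%N by lia.
move: {e4 e5 w1 w2} W1 W2 => W1 W2.
have vw : (j + 5 <= w)%N by nia.
(* The remainder [i] fixes the number [j + 5 + i] of base points, the quotient [q] the number of
   base edges. *)
have := divn_eq (w - (j + 5)) l.+1.
have := ltn_pmod (w - (j + 5)) (ltn0Sn l).
move: (_ %/ _)%N (_ %% _)%N => q i il ew.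
have {ew} ew : (w = j + 5 + i + l.+1 * q)%N by lia.
rewrite ew; apply: realizable_cone; [lia|lia|].
rewrite leq_uphalf_double -muln2; apply/andP; split.
  have : (l.+1 * (j + 5 + i) <= l.+1 * (q * 2))%N; last first.
    by rewrite leq_pmul2l // muln2.
  have : ((l + 3) * (j + 5 + l) <= (j + l + 4) * (j + l + 3))%N.
    by move: j2; clear; nia.
  have : ((l + 3) * (j + 5 + i) <= (l + 3) * (j + 5 + l))%N by rewrite leq_mul2l; lia.
  by move: W1; rewrite ew; clear; lia.
have b := mul_bin2 (j + 5 + i).
have : (2 * q <= (j + 5) * (j + 4))%N; last by nia.
have : (l.+1 * (2 * q) <= l.+1 * ((j + 5) * (j + 4)))%N; last first.
  by rewrite leq_pmul2l.
have : (l * (l + 3) <= l * (j * j + 7 * j + 14))%N by rewrite leq_mul2l lj orbT.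
by move: W2; rewrite ew; clear; lia.
Qed.

(** * The full range at each level *)

(* The largest weight needed at level [l]: it meets the lower end of the range at
   level [l - 1]. *)
Definition cap n l : int := if l == 2%N then ((n + 1) ^ 2 %/ 8)%N%:Z
  else 'C(n - l + 1, 2)%:Z - 1.

Definition full_range n l := forall w : int,
  bdiff n l + 'C(n - l, 2)%:Z <= w -> w <= cap n l -> realizable n l w.

Lemma full_range2 n : (5 <= n)%N -> full_range n 2.
Proof.
move=> n5 w; rewrite /cap /= => w1 w2; apply: realizable_graph => //.
  case: n n5 w1 {w2} => [|[|n]] // n5; rewrite !bdiffS /= subn2 /= /bdiff !bin1.
  by rewrite ?bin0; have := mul_bin2 n; lia.
have := leq_trunc_div ((n + 1) ^ 2) 8; lia.
Qed.

(** By Pascal's rule, the lower end one level down, plus the weight of the complete family, is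
    exactly the lower end here. *)
Lemma full_range_apex n l w : (2 * l + 8 <= n)%N -> full_range n.-1 l.+2 ->
  bdiff n l.+3 + 'C(n - l.+3, 2)%:Z <= w -> w <= bdiff n.-1 l.+3 + cap n.-1 l.+2 ->
  realizable n l.+3 w.
Proof.
case: n => [|n] ln IH; first by lia.
rewrite bdiffS subSS /= in IH * => w1 w2.
have -> : w = bdiff n l.+3 + (w - bdiff n l.+3) by lia.
apply: realizable_apex; first by lia.
by apply: IH; lia.
Qed.

(** Bridges the gap at level 3 between one joined point and the range on [n - 1] points: of two
    points joined over [n - 2] points, one takes the least weight [z], the other the rest. *)
Lemma realizable_gap3 n r : (9 <= n)%N -> full_range n.-2 2 ->
  ((n ^ 2) %/ 8 < r)%N -> (r < 'C(n - 4, 2))%N ->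
  realizable n 3 (bdiff n.-1 3 + r%:Z).
Proof.
move=> n9 IH r1 r2.
have [m en] : exists m, n = m.+4.+1 by exists (n - 5)%N; lia.
rewrite {}en /= in n9 IH r1 r2 *.
pose z := bdiff m.+3 2 + 'C(m.+1, 2)%:Z.
have b1 := mul_bin2 m.+1; have b3 := bdiff2 m.+3.
have r1' : (m.+4.+1 * m.+4.+1 < 8 * r.+1)%N.
  have := divn_eq (m.+4.+1 ^ 2) 8; have := ltn_pmod (m.+4.+1 ^ 2) (isT : 0 < 8)%N.
  by rewrite -{2}mulnn; lia.
rewrite !subSS subn0 in r2.
have r2' : (2 * r + 2 <= m * m + m)%N by lia.
have -> : bdiff m.+4 3 + r%:Z = bdiff m.+3 3 + z + (r%:Z - 'C(m.+1, 2)%:Z).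
  by rewrite bdiffS /z; lia.
have V : 3 * (2 * bdiff m.+3 2) = (m%:Z + 3) * (m%:Z + 2) * (2 - m%:Z).
  by rewrite mulrA b3; lia.
have cap0 : 0 <= cap m.+3 2 by [].
apply: realizable_apex2; first by lia.
  apply: IH; first by rewrite /z subSS subSS subn0.
  apply: le_trans cap0; rewrite /z.
  by move: {r1 r2 r1' r2'} b1 V n9; move: (bdiff _ _) ('C(_, 2)) => v c; nia.
apply: IH; last by apply: le_trans cap0; lia.
rewrite subSS subSS subn0.
by move: {r1 r2 r2'} r1' b1 V n9; move: (bdiff _ _) ('C(_, 2)) => v c; nia.
Qed.

(** For [l] large against [j * j], two points are joined over [2 * l + 7] points, where the complete
    family has weight 0. One takes the cap [z]; the remainder [w - z] is at most [z]. *)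
Lemma realizable_two_mid l j w : full_range (2 * l + 7) l.+2 ->
    (j * j + 7 * j + 14 < l + 3)%N ->
    ('C(j + l + 4, 2) <= w)%N -> (w < 'C(j + l + 5, 2))%N ->
    (2 <= j)%N ->
  realizable (2 * l + j + 7) l.+3 w%:Z.
Proof.
move=> IH lj w1 w2 j2.
apply: (@realizable_mono (2 * l + 7).+2); first by lia.
have mid : bdiff (2 * l + 7) l.+3 = 0.
  by rewrite -[RHS](bdiff_mid l.+3); congr bdiff; lia.
pose z := 'C(l + 6, 2)%:Z - 1.
have -> : w%:Z = bdiff (2 * l + 7) l.+3 + z + (w%:Z - z) by lia.
have b4 := mul_bin2 (j + l + 4); have b5 := mul_bin2 (j + l + 5).
have b6 := mul_bin2 (l + 6).
have z0 : 0 <= z by rewrite /z; lia.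
have zcap : cap (2 * l + 7) l.+2 = z.
  rewrite /cap ifN //; last by lia.
  by rewrite /z; congr (Posz 'C(_, 2) - 1); lia.
have low : bdiff (2 * l + 7) l.+2 + 'C(2 * l + 7 - l.+2, 2)%:Z <= 0.
  have := @bdiff_below_mid l.+2 _; rewrite (_ : 2 * l.+2 + 3 = 2 * l + 7)%N; last lia.
  by rewrite (_ : l.+2 + 3 = 2 * l + 7 - l.+2)%N; [apply; lia|lia].
apply: realizable_apex2; first by lia.
  by apply: IH; [apply: le_trans low z0|rewrite zcap].
apply: IH; rewrite ?zcap.
  apply: le_trans low _; rewrite /z.
  move: {zcap z0 mid z} b4 b6 w1; move: ('C(_, 2)) ('C(_, 2)) => c d.
  by move: j2; clear; nia.
rewrite /z.
move: {zcap z0 mid low z} b5 b6 w2; move: ('C(_, 2)) ('C(_, 2)) => c d.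
by move: j2 lj; clear; nia.
Qed.

Lemma full_range_high n l : (2 * l + 8 <= n)%N ->
  (forall c, (2 * l + 6 <= c)%N -> full_range c l.+2) -> full_range n l.+3.
Proof.
move=> + IHl; elim: n => [|n IHn] ln; first by lia.
have [ln2|ln2] := leqP (2 * l + 8) n; last first.
  have en : n.+1 = (2 * l + 8)%N by lia.
  move=> w w1 w2.
  have [w3|w3] := leP w (bdiff n l.+3 + cap n l.+2).
    by apply: full_range_apex w1 w3; [lia|apply: IHl; lia].
  have mid : bdiff n l.+3 = 0 by rewrite -[RHS](bdiff_mid l.+3); congr bdiff; lia.
  (* Above level 3 the two caps agree and nothing is left. At level 3 on 8 points the weights 9 to
     14 come from cones with 6 base points. *)
  case: l => [|l] in IHl IHn ln ln2 en w1 w2 w3 mid *; last first.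
    suff : cap n.+1 l.+4 = cap n l.+3 by lia.
    by rewrite /cap /= subSS.
  have en7 : n = 7%N by lia.
  have w8 : 8 < w by move: w3; rewrite mid en7.
  have w14 : w <= 14 by move: w2; rewrite en7.
  have -> : w = (6 + 1 * (`|w|%N - 6))%N%:Z by lia.
  by rewrite en7; apply: realizable_cone => //=; rewrite (_ : 'C(6, 2) = 15%N) //; lia.
move=> w w1 w2.
have [w3|w3] := leP w (bdiff n l.+3 + cap n l.+2).
  by apply: full_range_apex w1 w3; [lia|apply: IHl; lia].
have [w4|w4] := ltP w 'C(n - l.+2, 2)%:Z; last first.
  have [j [en j2]] : exists j, n.+1 = (2 * l + j + 7)%N /\ (2 <= j)%N.
    by exists (n.+1 - (2 * l + 7))%N; lia.
  have ew : w = `|w|%N%:Z by rewrite gez0_abs //; lia.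
  have e1 : (n - l.+2 = j + l + 4)%N by lia.
  have e2 : (n.+1 - l.+3 + 1 = j + l + 5)%N by lia.
  rewrite /cap /= e2 in w2; rewrite e1 in w4.
  rewrite {}ew in w2 w4 *; rewrite en.
  have [lj|lj] := leqP (l + 3) (j * j + 7 * j + 14).
    by apply: realizable_cone_range; lia.
  by apply: realizable_two_mid; [apply: IHl; lia| lia..].
have [w5|w5] := leP (bdiff n l.+3 + 'C(n - l.+3, 2)%:Z) w.
  apply: (realizable_mono (leqnSn n)); apply: IHn => //.
  by rewrite /cap /= (_ : n - l.+3 + 1 = n - l.+2)%N; lia.
(* Between the joined families and the range on [n] points a gap is possible only at level 3. *)
case: l => [|l] in IHl IHn ln ln2 w1 w2 w3 w4 w5 *; last first.
  suff : 'C(n - l.+4, 2)%:Z <= cap n l.+3 + 1 by lia.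
  rewrite /cap /= subrK lez_nat; apply: leq_bin2l; lia.
have -> : w = bdiff n 3 + `|w - bdiff n 3|%N%:Z.
  by rewrite gez0_abs; [lia | move: w3; rewrite /cap /=; lia].
apply: (@realizable_gap3 n.+1); first by lia.
- by apply: IHl; rewrite /=; lia.
- by rewrite -addn1; move: w3; rewrite /cap /=; lia.
- by rewrite subSS; move: w3; rewrite /cap /=; lia.
Qed.

Lemma full_rangeP n l : (2 <= l)%N -> (2 * l + 2 <= n)%N -> full_range n l.
Proof.
case: l => [|[|l]] // _; elim: l n => [|l IHl] n ln.
  by apply: full_range2; lia.
by apply: full_range_high => [|c lc]; [lia|apply: IHl; lia].
Qed.

(** * Choosing the level *)

Lemma ex_level n l (m : int) : (2 <= l)%N -> (l < n)%N ->
  'C(n, 2)%:Z - ((n + 1) ^ 2 %/ 8)%N%:Z <= m ->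
  m <= 'C(n, l.+1)%:Z - 'C(n - l, 2)%:Z ->
  exists i, [/\ (2 <= i <= l)%N, 'C(n, i)%:Z - cap n i <= m
    & m <= 'C(n, i.+1)%:Z - 'C(n - i, 2)%:Z].
Proof.
move=> + + m1; elim: l => // l IHl l2 ln m2.
have [m3|m3] := leP ('C(n, l.+1)%:Z - cap n l.+1) m.
  by exists l.+1; split=> //; lia.
have [l1|l1] := eqVneq l 1%N; first by move: m3; rewrite l1 /cap /=; lia.
have cap_next : cap n l.+1 = 'C(n - l, 2)%:Z - 1.
  by rewrite /cap eqSS (negbTE l1); congr (Posz 'C(_, 2) - 1); lia.
have [|||i [il i1 i2]] := IHl; [lia|lia|lia|].
by exists i; split=> //; lia.
Qed.

(* With the hypothesis 0 < n the claim fails for n = 1 (m = 0) and n = 2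
   (m = 0, 1): the bounds on m are satisfied but no l is available.  Those are
   the only two values of n excluded here.
   uphalf n is the ceiling of n / 2, and n./2 is its floor. *)
Theorem theorem1p2 (n k : nat) (m : int)
  (hn : (2 < n)%N)
  (hk : k = uphalf n)
  (hlow : 'C(n, 2)%:Z - ((n + 1) ^ 2 %/ 8)%N%:Z <= m)
  (hupp : m <= 'C(n, k)%:Z - (k * uphalf (k + 1))%N%:Z) :
  exists (l : nat) (A : {set {set 'I_n}}),
    [/\ (2 <= l <= (n - 2)./2)%N,
        maximal_antichain A,
        A \subset level n l :|: level n l.+1
      & #|A|%:Z = m].
Proof.
(* For [n] from 3 to 5 the bounds on [m] contradict each other. *)
have n6 : (6 <= n)%N.
  rewrite leqNgt; apply/negP => n6.
  have low_upp := le_trans hlow hupp; rewrite {}hk in low_upp.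
  have [en|[en|en]] : n = 3%N \/ n = 4%N \/ n = 5%N by lia.
  - have e1 : ('C(3, 2) = 3)%N by [].
    have e2 : (((3 + 1) ^ 2 %/ 8) = 2)%N by [].
    by rewrite en [uphalf 3]/= e1 e2 in low_upp.
  - have e1 : ('C(4, 2) = 6)%N by [].
    have e2 : (((4 + 1) ^ 2 %/ 8) = 3)%N by [].
    by rewrite en [uphalf 4]/= e1 e2 in low_upp.
  - have e1 : ('C(5, 2) = 10)%N by [].
    have e2 : (((5 + 1) ^ 2 %/ 8) = 4)%N by [].
    have e3 : ('C(5, 3) = 10)%N by [].
    by rewrite en [uphalf 5]/= e1 e2 e3 in low_upp.
pose L := (n - 2)./2.
have L2 : (2 <= L)%N by rewrite /L; lia.
(* [L + 1] is [k] or [n - k], and ['C(k + 1, 2)] is at most [k * uphalf (k + 1)]. *)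
have hL : m <= 'C(n, L.+1)%:Z - 'C(n - L, 2)%:Z.
  have -> : 'C(n, L.+1) = 'C(n, k).
    have [en|en] : k = L.+1 \/ k = (n - L.+1)%N by rewrite hk /L; lia.
      by rewrite en.
    by rewrite en bin_sub //; rewrite /L; lia.
  have -> : (n - L = k + 1)%N by rewrite hk /L; lia.
  have := mul_bin2 (k + 1).
  have : (k * (k + 1) <= 2 * (k * uphalf (k + 1)))%N.
    by rewrite mulnCA leq_mul2l; lia.
  by lia.
have Ln : (L < n)%N by rewrite /L; lia.
have [i [/andP[i2 iL] m1 m2]] := ex_level L2 Ln hlow hL.
have rw : realizable n i ('C(n, i)%:Z - m).
  by apply: full_rangeP; rewrite ?/bdiff; move: iL; rewrite /L; lia.
have [E [TE pE wE]] := rw _ [set: 'I_n] (eq_leq (esym (etrans (cardsT _) (card_ord n)))).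
have [|mA subA sA] := pure_maximal _ TE pE; first by rewrite /L in iL; lia.
exists i, (level n i :\: E :|: cl E); split=> //; first by rewrite i2.
by rewrite sA wE; lia.
Qed.
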